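(* Let $m\in\mathbb{N}$, $m\ge1$, and let $\mathrm{Iso}(H_m)$ be the group of intrinsic isometries of the generalized Henneberg surface $H_m$. Then $\mathrm{Iso}(H_m)$ consists exactly of the maps induced on $H_m$ by the elements of the group $\Gamma_m$ of transformations of $\mathbb{C}\setminus\{0\}$ generated by: (i) if $m$ is odd, $re^{i\theta}\mapsto re^{i(\pi-\theta)}$ (which induces on $H_m$ the reflection of $\mathbb{R}^3$ in the $(x_2,x_3)$-plane) and $re^{i\theta}\mapsto re^{i(\theta+\pi+\frac{\pi}{m+1})}$ (which induces the rotation of angle $\frac{\pi}{m+1}$ about the $x_3$-axis composed with the reflection in the $(x_1,x_2)$-plane); (ii) if $m$ is even, $re^{i\theta}\mapsto re^{i(\pi-\theta)}$ (which induces the reflection in the $(x_2,x_3)$-plane), $re^{i\theta}\mapsto re^{i(\theta+\frac{2\pi}{m+1})}$ (which induces a rotation of angle of absolute value $\frac{2\pi}{m+1}$ about the $x_3$-axis) and $re^{i\theta}\mapsto re^{i(\theta+\pi)}$ (which induces the reflection in the $(x_1,x_2)$-plane). In particular, $\mathrm{Iso}(H_m)$ is isomorphic to the dihedral group $D_{2m+2}$ if $m$ is odd, and to $D_{m+1}\times\mathbb{Z}_2$ if $m$ is even.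
   Context: $D_n$ denotes the dihedral group of order $2n$. Let $\epsilon_m=1$ if $m$ is odd and $\epsilon_m=i$ if $m$ is even. $H_m$ is the 1-sided branched minimal surface with Weierstrass data $g(z)=z$, $\omega=\epsilon_m z^{-m-3}(z^{2m+2}-1)\,dz$ on $\mathbb{C}\setminus\{0\}$: the map $X=\mathrm{Re}\int\left(\frac12(1-g^2)\omega,\frac i2(1+g^2)\omega,g\omega\right)$, normalized by a translation, is $$X(re^{i\theta})=\begin{pmatrix}\frac{\cos(m\theta)}{2m}(r^m-r^{-m})-\frac{\cos((m+2)\theta)}{2(m+2)}(r^{m+2}-r^{-m-2})\\ -\frac{\sin(m\theta)}{2m}(r^m-r^{-m})-\frac{\sin((m+2)\theta)}{2(m+2)}(r^{m+2}-r^{-m-2})\\ \frac{\cos((m+1)\theta)}{m+1}(r^{m+1}+r^{-m-1})\end{pmatrix}\ (m\text{ odd}),$$ $$X(re^{i\theta})=\begin{pmatrix}-\frac{\sin(m\theta)}{2m}(r^m+r^{-m})+\frac{\sin((m+2)\theta)}{2(m+2)}(r^{m+2}+r^{-m-2})\\ -\frac{\cos(m\theta)}{2m}(r^m+r^{-m})-\frac{\cos((m+2)\theta)}{2(m+2)}(r^{m+2}+r^{-m-2})\\ \frac{\sin((m+1)\theta)}{m+1}(r^{-m-1}-r^{m+1})\end{pmatrix}\ (m\text{ even}),$$ and it factors through the quotient $(\mathbb{C}\setminus\{0\})/\langle A\rangle$, $A(z)=-1/\overline z$. Intrinsic isometries of $H_m$ are the diffeomorphisms of $(\mathbb{C}\setminus\{0\})/\langle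 A\rangle$ preserving the induced metric $ds^2=\frac14(1+|z|^2)^2|\omega|^2$ (which degenerates exactly at the branch points, the classes of the $(2m+2)$-th roots of unity). A transformation $T$ of $\mathbb{C}\setminus\{0\}$ commuting with $A$ induces a map of the quotient; it induces the isometry $\Psi$ of $\mathbb{R}^3$ on $H_m$ if $X\circ T=\Psi\circ X$. *)

(* Defs.v *)
From Stdlib Require Import Reals Lra ProofIrrelevance.
From Coquelicot Require Import Coquelicot.
From mathcomp Require Import all_boot fingroup gproduct zmodp extremal.

Set Implicit Arguments.
Unset Strict Implicit.
Unset Printing Implicit Defensive.

Open Scope R_scope.

Record cstar := Cstar { cval :> C; cval_neq0 : cval <> RtoC 0 }.

Lemma cval_inj (z w : cstar) : cval z = cval w -> z = w.
Proof.
case: z w => [z hz] [w hw] /= e; move: hz; rewrite e => hz.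
by rewrite (proof_irrelevance _ hz hw).
Qed.

Definition expi (t : R) : C := (cos t, sin t).

Lemma expi_neq0 t : expi t <> RtoC 0.
Proof. by case=> hc hs; have := sin2_cos2 t; rewrite hc hs /Rsqr; lra. Qed.

Lemma polar_neq0 (r : posreal) t : (RtoC r * expi t)%C <> RtoC 0.
Proof.
apply: Cmult_neq_0; last exact: expi_neq0.
by move=> /RtoC_inj; have := cond_pos r; lra.
Qed.

Definition polar (r : posreal) (t : R) : cstar := Cstar (@polar_neq0 r t).

Lemma modulus_gt0 (z : cstar) : 0 < Cmod z.
Proof. exact: (Cmod_gt_0 _).1 (@cval_neq0 z). Qed.

Definition modulus (z : cstar) : posreal := mkposreal _ (modulus_gt0 z).

(* principal argument, in (-PI, PI] *)
Definition arg (z : cstar) : R :=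
  if Rle_dec 0 (Im z) then acos (Re z / Cmod z) else - acos (Re z / Cmod z).

Lemma modulus_argE (z : cstar) : polar (modulus z) (arg z) = z.
Proof.
apply: cval_inj; rewrite /= /expi /arg.
have := modulus_gt0 z; case: (cval z) => x y /=; set r := Cmod _ => hr.
have hr2 : r * r = x * x + y * y.
  by rewrite /r /Cmod sqrt_sqrt /=; nra.
have hb : -1 <= x / r <= 1.
  by split; [apply/Rle_div_r | apply/Rle_div_l] => //; nra.
have hs : sqrt (1 - (x / r)²) = Rabs y / r.
  have -> : 1 - (x / r)² = (Rabs y / r)².
    rewrite !Rsqr_div' -(Rsqr_abs y) /Rsqr (_ : y * y = r * r - x * x); last lra.
    by field; lra.
  by rewrite sqrt_Rsqr //; apply: Rdiv_le_0_compat => //; apply: Rabs_pos.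
rewrite /RtoC /Cmult /=; case: Rle_dec => hy.
  rewrite cos_acos // sin_acos // hs Rabs_pos_eq //.
  by congr pair; field; lra.
rewrite cos_neg sin_neg cos_acos // sin_acos // hs Rabs_left; last lra.
by congr pair; field; lra.
Qed.

Lemma modulus_polar r t : pos (modulus (polar r t)) = r.
Proof.
rewrite /= Cmod_mult Cmod_R Rabs_pos_eq; last by have := cond_pos r; lra.
rewrite /Cmod /expi /=.
rewrite (_ : _ + _ = 1) ?sqrt_1; first by ring.
by have := sin2_cos2 t; rewrite /Rsqr; lra.
Qed.

Lemma arg_polar r t :
  cos (arg (polar r t)) = cos t /\ sin (arg (polar r t)) = sin t.
Proof.
have := congr1 cval (modulus_argE (polar r t)).
rewrite [LHS]/= (modulus_polar r t : Cmod _ = _) /= /expi /RtoC /Cmult /=.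
have := cond_pos r => hr [h1 h2].
by split; apply: (Rmult_eq_reg_l r); lra.
Qed.

Lemma cos_sin_natmul (a b : R) (n : nat) : cos a = cos b -> sin a = sin b ->
  cos (INR n * a) = cos (INR n * b) /\ sin (INR n * a) = sin (INR n * b).
Proof.
move=> hc hs; elim: n => [|n [IHc IHs]]; first by rewrite !Rmult_0_l.
by rewrite S_INR !Rmult_plus_distr_r !Rmult_1_l !cos_plus !sin_plus
  IHc IHs hc hs.
Qed.

Lemma polar_eq (r s : posreal) (a b : R) : pos r = s ->
  cos a = cos b -> sin a = sin b -> polar r a = polar s b.
Proof. by move=> er ec es; apply: cval_inj; rewrite /= /expi er ec es. Qed.

Lemma antipode_neq0 (z : cstar) : (RtoC (-1) / Cconj z)%C <> RtoC 0.
Proof.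
have hz : Cconj z <> RtoC 0.
  move=> h; apply: (@cval_neq0 z); case: (cval z) h => x y /= [-> hy].
  by congr pair; lra.
apply: Cmult_neq_0; first by move=> /RtoC_inj; lra.
move=> h; have := Cinv_r _ hz; rewrite h Cmult_0_r => /RtoC_inj; lra.
Qed.

Definition antipode (z : cstar) : cstar := Cstar (@antipode_neq0 z).

Lemma antipodeK : cancel antipode antipode.
Proof.
move=> z; apply: cval_inj => /=.
have := modulus_gt0 z; case: (cval z) => x y /=; rewrite /Cmod => h.
have {}h : x * x + y * y <> 0.
  by move=> e; move: h; rewrite (_ : _ + _ = 0) ?sqrt_0 /=; lra.
rewrite /Cdiv /Cinv /Cconj /Cmult /RtoC /=.
by congr pair; field; repeat split; nra.
Qed.

Definition orbit (z : cstar) : cstar -> Prop :=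
  fun w => w = z \/ w = antipode z.

(* (C \ {0}) / <A> as a set of orbits *)
Definition Hquot := {S : cstar -> Prop | exists z, S = orbit z}.

Definition cls (z : cstar) : Hquot :=
  exist _ (orbit z) (ex_intro _ z erefl).

Definition smooth_on (U : C -> Prop) (f : C -> C) : Prop :=
  forall (z : C) (n : nat), U z ->
    ex_diff_n (fun x y => Re (f (x, y))) n (Re z) (Im z) /\
    ex_diff_n (fun x y => Im (f (x, y))) n (Re z) (Im z).

(* real differential of [f] at [z], applied to the tangent vector [v] *)
Definition rdiff (f : C -> C) (z v : C) : C :=
  (Derive (fun x => Re (f (x, Im z))) (Re z) * Re v +
     Derive (fun y => Re (f (Re z, y))) (Im z) * Im v,
   Derive (fun x => Im (f (x, Im z))) (Re z) * Re v +
     Derive (fun y => Im (f (Re z, y))) (Im z) * Im v).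

(* [f] is a smooth expression of [phi] on the open set [U] of C \ {0}.  The
   charts of the quotient are the local inverses of the covering [cls]. *)
Definition local_lift (phi : Hquot -> Hquot) (U : C -> Prop) (f : C -> C) :=
  [/\ open U, (forall z, U z -> z <> RtoC 0), smooth_on U f
    & forall z : cstar, U z ->
        exists w : cstar, cval w = f z /\ phi (cls z) = cls w].

Definition smooth_quot (phi : Hquot -> Hquot) : Prop :=
  forall z : cstar, exists U f, U (cval z) /\ local_lift phi U f.

Definition diffeo_quot (phi : Hquot -> Hquot) : Prop :=
  smooth_quot phi /\
  exists psi, [/\ smooth_quot psi, cancel phi psi & cancel psi phi].

(* [omega m z v] and [ds2 m z v]: the Weierstrass 1-form and the induced
   metric (1 + |z|^2)^2 |omega|^2 / 4, at [z] on the tangent vector [v]. *)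
Definition eps (m : nat) : C := if odd m then RtoC 1 else Ci.

Definition omega (m : nat) (z v : C) : C :=
  (eps m * (/ Cpow z m.+3 * (Cpow z (2 * m + 2)%N - RtoC 1)) * v)%C.

Definition ds2 (m : nat) (z v : C) : R :=
  / 4 * (1 + Cmod z ^ 2) ^ 2 * Cmod (omega m z v) ^ 2.

(* [local_lift] determines [f] up to [antipode], which preserves [ds2]. *)
Definition preserves_metric (m : nat) (phi : Hquot -> Hquot) : Prop :=
  forall U f, local_lift phi U f -> forall z v : C, U z ->
    ds2 m (f z) (rdiff f z v) = ds2 m z v.

(* Iso(H_m); the group law is composition *)
Definition Iso (m : nat) (phi : Hquot -> Hquot) : Prop :=
  diffeo_quot phi /\ preserves_metric m phi.

Definition Hparam (m : nat) (r t : R) : R * R * R :=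
  let a := INR m in let b := INR m.+1 in let c := INR m.+2 in
  if odd m then
    (cos (a * t) / (2 * a) * (r ^ m - / r ^ m)
       - cos (c * t) / (2 * c) * (r ^ m.+2 - / r ^ m.+2),
     - (sin (a * t) / (2 * a)) * (r ^ m - / r ^ m)
       - sin (c * t) / (2 * c) * (r ^ m.+2 - / r ^ m.+2),
     cos (b * t) / b * (r ^ m.+1 + / r ^ m.+1))
  else
    (- (sin (a * t) / (2 * a)) * (r ^ m + / r ^ m)
       + sin (c * t) / (2 * c) * (r ^ m.+2 + / r ^ m.+2),
     - (cos (a * t) / (2 * a)) * (r ^ m + / r ^ m)
       - cos (c * t) / (2 * c) * (r ^ m.+2 + / r ^ m.+2),
     sin (b * t) / b * (/ r ^ m.+1 - r ^ m.+1)).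

(* [X_polar], [flip_polar] and [turn_polar] show that the choice of argument
   is immaterial. *)
Definition X (m : nat) (z : cstar) : R * R * R :=
  Hparam m (modulus z) (arg z).

Lemma X_polar m r t : X m (polar r t) = Hparam m r t.
Proof.
rewrite /X modulus_polar /Hparam.
have [hc hs] := arg_polar r t.
have [h1 h1'] := cos_sin_natmul m hc hs.
have [h2 h2'] := cos_sin_natmul m.+1 hc hs.
have [h3 h3'] := cos_sin_natmul m.+2 hc hs.
by rewrite h1 h1' h2 h2' h3 h3'.
Qed.

Definition flip (z : cstar) : cstar := polar (modulus z) (PI - arg z).

Definition turn (a : R) (z : cstar) : cstar := polar (modulus z) (arg z + a).

Lemma flip_polar r t : flip (polar r t) = polar r (PI - t).
Proof.
have [hc hs] := arg_polar r t.
apply: polar_eq; first exact: modulus_polar.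
  by rewrite !cos_minus hc hs.
by rewrite !sin_minus hc hs.
Qed.

Lemma turn_polar a r t : turn a (polar r t) = polar r (t + a).
Proof.
have [hc hs] := arg_polar r t.
apply: polar_eq; first exact: modulus_polar.
  by rewrite !cos_plus hc hs.
by rewrite !sin_plus hc hs.
Qed.

Inductive generated (T : Type) (G : (T -> T) -> Prop) : (T -> T) -> Prop :=
  | gen_base f : G f -> generated G f
  | gen_id : generated G id
  | gen_comp f g : generated G f -> generated G g -> generated G (f \o g)
  | gen_inv f g : generated G f -> cancel f g -> cancel g f -> generated G g.

Definition Gamma (m : nat) : (cstar -> cstar) -> Prop :=
  if odd m then
    generated (fun T => T = flip \/ T = turn (PI + PI / INR m.+1))
  else
    generated (fun T =>
      [\/ T = flip, T = turn (2 * PI / INR m.+1) | T = turn PI]).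

Definition commutes_antipode (T : cstar -> cstar) : Prop :=
  forall z, T (antipode z) = antipode (T z).

Definition induces (T : cstar -> cstar) (phi : Hquot -> Hquot) : Prop :=
  commutes_antipode T /\ forall z, phi (cls z) = cls (T z).

Definition induces_space (m : nat) (T : cstar -> cstar)
  (Psi : R * R * R -> R * R * R) : Prop := forall z, X m (T z) = Psi (X m z).

Definition reflect_x2x3 (p : R * R * R) : R * R * R :=
  let: (x1, x2, x3) := p in (- x1, x2, x3).

Definition reflect_x1x2 (p : R * R * R) : R * R * R :=
  let: (x1, x2, x3) := p in (x1, x2, - x3).

Definition rotate_x3 (a : R) (p : R * R * R) : R * R * R :=
  let: (x1, x2, x3) := p in
  (cos a * x1 - sin a * x2, sin a * x1 + cos a * x2, x3).

(* The self-maps of [T] in [S] form, under composition, a group isomorphic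
   to [gT]. *)
Definition isomorphic_to (T : Type) (S : (T -> T) -> Prop)
  (gT : finGroupType) : Prop :=
  exists F : gT -> (T -> T),
    [/\ injective F,
        F 1%g = id,
        forall x y : gT, F (x * y)%g = F x \o F y
      & forall f, S f <-> exists x, F x = f].

(* Main.v *)
(** Write v = 1 + |z|^2 and omega = h dz up to a unit.  A lift f of an
    isometry to C \ {0} is conformal; replacing f by its conjugate if necessary,
    it is holomorphic and satisfies (1 + |f|^2) |h(f)| |f'| = v |h|.  The
    holomorphic factor K = h(f) f' / h drops out when the Laplacian of the
    logarithm is taken, which leaves |f'| / (1 + |f|^2) = 1 / v: f is a local
    isometry of the round metric, so the height (|f|^2 - 1) / (|f|^2 + 1) is the
    restriction of a linear function of unit norm to the sphere, up to the sign
    created by the choice of lift.  The region |z| > 1 contains no branch point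
    and is connected, so this linear function is globally defined there up to
    sign; if it were not plus or minus the third coordinate, the height would
    reach 1 or -1 at some z with |z| >= 1, that is, f would take the value 0 or
    infinity.  Hence |f| = |z| or 1 / |z|, and up to the antipodal map f is
    z -> c z or z -> c conj(z) with |c| = 1.  Invariance of the metric then
    forces c^(2m+2) = 1, and connectedness makes c and the orientation global;
    the region |z| < 1 is covered by the antipodal map. *)

Require Import Defs.
From Stdlib Require Import ZArith Reals Lra FunctionalExtensionality.
From Stdlib Require Import PropExtensionality ProofIrrelevance ClassicalEpsilon.
From Coquelicot Require Import Coquelicot.
From mathcomp Require Import all_boot fingroup morphism presentation gproduct.
From mathcomp Require Import zmodp cyclic extremal zify.

Set Implicit Arguments.
Unset Strict Implicit.
Unset Printing Implicit Defensive.

(** * Directional and complex derivatives *)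

(** The analysis uses only partial derivatives along the two axes: no logarithm, no integral. The
    Laplacian of the logarithm is split in two: a first differentiation gives a formula for K'/K,
    and the Cauchy-Riemann equation for K'/K is the second. The same formula with 1/f' in the place
    of K yields f'', hence the Hessian of the height, and from it two quantities that are locally
    constant: the coefficients of the linear function. The height has to come before the multiplier
    c: locally f may be any rotation of the sphere, and only the two missing points 0 and infinity
    single out the vertical axis. A lift is determined only up to the antipodal map, so every global
    statement is phrased by something blind to that choice: the square of the height, or a product
    of two functions of which one must vanish. The branch points lie on the unit circle. Nothing is
    differentiated there; identities reach the circle by continuity from outside. *)

Definition rder (f : R -> R) (t l : R) : Prop := is_derive f t l.

Lemma rder_eq f t l l' : rder f t l -> l = l' -> rder f t l'.
Proof. by move=> h <-. Qed.

Lemma rder_ext f g t l : (forall s, f s = g s) -> rder f t l -> rder g t l.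
Proof. exact: is_derive_ext. Qed.

Lemma rder_loc f g t l :
  locally t (fun s => f s = g s) -> rder f t l -> rder g t l.
Proof. exact: is_derive_ext_loc. Qed.

Lemma rder_unique f t l l' : rder f t l -> rder f t l' -> l = l'.
Proof. by move=> /is_derive_unique <- /is_derive_unique <-. Qed.

Lemma rder_cst (c t : R) : rder (fun=> c) t 0.
Proof. exact: is_derive_const. Qed.

Lemma rder_id t : rder (fun s => s) t 1.
Proof. exact: is_derive_id. Qed.

Lemma rder_add f g t a b :
  rder f t a -> rder g t b -> rder (fun s => f s + g s) t (a + b).
Proof. exact: is_derive_plus. Qed.

Lemma rder_opp f t a : rder f t a -> rder (fun s => - f s) t (- a).
Proof. exact: is_derive_opp. Qed.

Lemma rder_sub f g t a b :
  rder f t a -> rder g t b -> rder (fun s => f s - g s) t (a - b).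
Proof. exact: is_derive_minus. Qed.

Lemma rder_mul f g t a b : rder f t a -> rder g t b ->
  rder (fun s => f s * g s) t (a * g t + f t * b).
Proof. by move=> hf hg; apply: is_derive_mult => // *; apply: Rmult_comm. Qed.

Lemma rder_inv f t a : rder f t a -> f t <> 0 ->
  rder (fun s => / f s) t (- a / (f t * f t)).
Proof.
move=> hf h0; apply: rder_eq (is_derive_inv _ _ _ hf h0) _.
by rewrite /= Rmult_1_r.
Qed.

Definition cder (g : R -> C) (t : R) (d : C) : Prop :=
  rder (fun s => Re (g s)) t (Re d) /\ rder (fun s => Im (g s)) t (Im d).

Lemma cder_eq g t d d' : cder g t d -> d = d' -> cder g t d'.
Proof. by move=> h <-. Qed.

Lemma cder_loc f g t l :
  locally t (fun s => f s = g s) -> cder f t l -> cder g t l.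
Proof.
move=> e [h1 h2]; split; [move: h1|move: h2]; apply: rder_loc;
  by apply: filter_imp e => s ->.
Qed.

Lemma cder_unique f t l l' : cder f t l -> cder f t l' -> l = l'.
Proof.
move=> [h1 h2] [h3 h4]; apply: injective_projections.
  exact: rder_unique h1 h3.
exact: rder_unique h2 h4.
Qed.

Lemma cder_cst c t : cder (fun=> c) t 0.
Proof. by split; apply: rder_cst. Qed.

Lemma cder_add f g t a b :
  cder f t a -> cder g t b -> cder (fun s => f s + g s)%C t (a + b)%C.
Proof. by move=> [? ?] [? ?]; split; apply: rder_add. Qed.

Lemma cder_opp f t a : cder f t a -> cder (fun s => - f s)%C t (- a)%C.
Proof. by move=> [? ?]; split; apply: rder_opp. Qed.

Lemma cder_sub f g t a b :
  cder f t a -> cder g t b -> cder (fun s => f s - g s)%C t (a - b)%C.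
Proof. by move=> hf hg; apply: cder_add hf (cder_opp hg). Qed.

Lemma cder_conj f t a : cder f t a -> cder (fun s => Cconj (f s)) t (Cconj a).
Proof. by move=> [? ?]; split => //; apply: rder_opp. Qed.

Lemma cder_mul f g t a b : cder f t a -> cder g t b ->
  cder (fun s => f s * g s)%C t (a * g t + f t * b)%C.
Proof.
move=> [h1 h2] [h3 h4]; split.
  apply: rder_eq (rder_sub (rder_mul h1 h3) (rder_mul h2 h4)) _.
  by rewrite /Re /Im /=; ring.
apply: rder_eq (rder_add (rder_mul h1 h4) (rder_mul h2 h3)) _.
by rewrite /Re /Im /=; ring.
Qed.

Definition nsq (z : C) : R := Re z * Re z + Im z * Im z.

Lemma nsq_ge0 z : 0 <= nsq z.
Proof. by rewrite /nsq; nra. Qed.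

Lemma nsq_gt0 z : z <> RtoC 0 -> 0 < nsq z.
Proof.
move=> h; have := nsq_ge0 z; case=> // e; case: h; case: z e => x y.
by rewrite /nsq /= => e; congr pair; nra.
Qed.

Lemma nsq_neq0 z : z <> RtoC 0 -> nsq z <> 0.
Proof. by move=> /nsq_gt0; lra. Qed.

Lemma nsq_eq0 z : nsq z = 0 -> z = RtoC 0.
Proof. by case: z => x y; rewrite /nsq /Re /Im /= => h; congr pair; nra. Qed.

Lemma nsq_mul z w : nsq (z * w)%C = nsq z * nsq w.
Proof. by rewrite /nsq /Re /Im /=; ring. Qed.

Lemma nsq_conj z : nsq (Cconj z) = nsq z.
Proof. by rewrite /nsq /Re /Im /=; ring. Qed.

Lemma nsq_Cmod z : nsq z = Cmod z ^ 2.
Proof.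
rewrite /Cmod /nsq /Re /Im pow2_sqrt; first by ring.
by rewrite /=; nra.
Qed.

Lemma nsq_inv z : z <> RtoC 0 -> nsq (/ z)%C = / nsq z.
Proof.
move=> h; have hn := nsq_neq0 h; apply: (Rmult_eq_reg_r (nsq z)) => //.
by rewrite -nsq_mul Cinv_l // Rinv_l // /nsq /=; ring.
Qed.

Lemma cder_inv f t a : cder f t a -> f t <> RtoC 0 ->
  cder (fun s => / f s)%C t (- a / (f t * f t))%C.
Proof.
move=> [h1 h2] /nsq_neq0 h0.
have hN := rder_add (rder_mul h1 h1) (rder_mul h2 h2).
have hI := rder_inv hN h0; split.
  apply: rder_ext (rder_eq (rder_mul h1 hI) _) => [s|].
    by rewrite /Re /Im /= /Rdiv !Rmult_1_r.
  move: h0; rewrite /nsq /Cinv /Cmult /Copp /Re /Im /=.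
  by case: (f t) a {h1 h2 hN hI} => x y [a b] /= h; field; nra.
apply: rder_ext (rder_eq (rder_mul (rder_opp h2) hI) _) => [s|].
  by rewrite /Re /Im /= /Rdiv !Rmult_1_r.
move: h0; rewrite /nsq /Cinv /Cmult /Copp /Re /Im /=.
by case: (f t) a {h1 h2 hN hI} => x y [a b] /= h; field; nra.
Qed.

Lemma cder_nsq f t a : cder f t a ->
  rder (fun s => nsq (f s)) t (2 * Re (Cconj (f t) * a)%C).
Proof.
move=> [h1 h2].
apply: rder_eq (rder_add (rder_mul h1 h1) (rder_mul h2 h2)) _.
by rewrite /Re /Im /=; ring.
Qed.

Lemma cder_scal r f t l a : rder r t l -> cder f t a ->
  cder (fun s => RtoC (r s) * f s)%C t (RtoC l * f t + RtoC (r t) * a)%C.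
Proof.
move=> h; apply: (@cder_mul (fun s => RtoC (r s)) f t (RtoC l)); split => //.
exact: rder_cst.
Qed.

(* Horizontal ([b = false]) and vertical ([b = true]) lines through a point. *)
Definition seg (b : bool) (z : C) (s : R) : C :=
  if b then (Re z, s) else (s, Im z).

Definition coord (b : bool) (z : C) : R := if b then Im z else Re z.

Definition axis (b : bool) : C := if b then Ci else RtoC 1.

Lemma seg_coord b z : seg b z (coord b z) = z.
Proof. by case: b z => [] []. Qed.

Definition rdir (G : C -> R) b z l := rder (fun s => G (seg b z s)) (coord b z) l.

Definition cdir (G : C -> C) b z d := cder (fun s => G (seg b z s)) (coord b z) d.

(** The Cauchy-Riemann equation is built in: the partial derivatives are [d] and [Ci * d]. No limit
    in a complex variable is taken, so that every rule reduces to one-variable calculus. *)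
Definition cdiff (G : C -> C) z d := forall b, cdir G b z (axis b * d)%C.

Lemma locally_seg (P : C -> Prop) b z :
  locally z P -> locally (coord b z) (fun s => P (seg b z s)).
Proof.
case=> eps h; exists eps => s hs; apply: h.
by case: b hs => hs; split => //=; apply: ball_center.
Qed.

Lemma rdir_loc G H b z l :
  locally z (fun w => G w = H w) -> rdir G b z l -> rdir H b z l.
Proof. by move=> /(@locally_seg _ b); apply: rder_loc. Qed.

Lemma cdir_loc G H b z l :
  locally z (fun w => G w = H w) -> cdir G b z l -> cdir H b z l.
Proof. by move=> /(@locally_seg _ b); apply: cder_loc. Qed.

Lemma rdir_on (V : C -> Prop) G H b z l : open V -> V z ->
  (forall w, V w -> G w = H w) -> rdir G b z l -> rdir H b z l.
Proof. by move=> oV Vz e; apply: rdir_loc; apply: filter_imp (oV z Vz). Qed.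

Lemma cdir_on (V : C -> Prop) G H b z l : open V -> V z ->
  (forall w, V w -> G w = H w) -> cdir G b z l -> cdir H b z l.
Proof. by move=> oV Vz e; apply: cdir_loc; apply: filter_imp (oV z Vz). Qed.

Lemma cdir_cst c b z : cdir (fun=> c) b z (RtoC 0).
Proof. exact: cder_cst. Qed.

Lemma cdir_conj F b z a :
  cdir F b z a -> cdir (fun w => Cconj (F w)) b z (Cconj a).
Proof. exact: cder_conj. Qed.

Lemma cdir_sub F G b z a c : cdir F b z a -> cdir G b z c ->
  cdir (fun w => F w - G w)%C b z (a - c)%C.
Proof. exact: cder_sub. Qed.

Lemma cdir_mul F G b z a c : cdir F b z a -> cdir G b z c ->
  cdir (fun w => F w * G w)%C b z (a * G z + F z * c)%C.
Proof. by move=> hF hG; have := cder_mul hF hG; rewrite /cdir seg_coord. Qed.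

Lemma cdir_inv F b z a : cdir F b z a -> F z <> RtoC 0 ->
  cdir (fun w => / F w)%C b z (- a / (F z * F z))%C.
Proof.
by move=> hF; rewrite -(seg_coord b z) => h; have := cder_inv hF h; rewrite !seg_coord.
Qed.

Lemma cdiff_eq G z d d' : cdiff G z d -> d = d' -> cdiff G z d'.
Proof. by move=> h <-. Qed.

Lemma cdiff_id z : cdiff (fun w => w) z 1.
Proof.
case=> /=; split; rewrite /= /Re /Im /=;
  by [apply: rder_eq (rder_cst _ _) _; ring | apply: rder_eq (rder_id _) _; ring].
Qed.

Lemma cdiff_cst c z : cdiff (fun=> c) z 0.
Proof. by move=> b; apply: cder_eq (cder_cst _ _) _; ring. Qed.

Lemma cdiff_sub F G z a b :
  cdiff F z a -> cdiff G z b -> cdiff (fun w => F w - G w)%C z (a - b)%C.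
Proof. by move=> hF hG c; apply: cder_eq (cder_sub (hF c) (hG c)) _; ring. Qed.

Lemma cdiff_add F G z a b :
  cdiff F z a -> cdiff G z b -> cdiff (fun w => F w + G w)%C z (a + b)%C.
Proof. by move=> hF hG c; apply: cder_eq (cder_add (hF c) (hG c)) _; ring. Qed.

Lemma cdiff_mul F G z a b : cdiff F z a -> cdiff G z b ->
  cdiff (fun w => F w * G w)%C z (a * G z + F z * b)%C.
Proof.
move=> hF hG c; apply: cder_eq (cder_mul (hF c) (hG c)) _.
by rewrite seg_coord; ring.
Qed.

Lemma cdiff_inv F z a : cdiff F z a -> F z <> RtoC 0 ->
  cdiff (fun w => / F w)%C z (- a / (F z * F z))%C.
Proof.
move=> hF h0 c; apply: cder_eq (cder_inv (hF c) _) _; rewrite seg_coord //.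
by field.
Qed.

Lemma rdir_nsq F b z a : cdir F b z a ->
  rdir (fun w => nsq (F w)) b z (2 * Re (Cconj (F z) * a)%C).
Proof. by move=> /cder_nsq; rewrite /rdir seg_coord. Qed.

(** Turns an equality of real derivatives along both axes into an equality of complex
    derivatives. *)
Lemma Cext_dir w w' :
  (forall b, Re (axis b * w)%C = Re (axis b * w')%C) -> w = w'.
Proof.
case: w w' => [a b] [c d] h; have := h false; have := h true.
by rewrite /Re /= => h1 h2; congr pair; lra.
Qed.

(** Two derivatives are what the curvature argument consumes: one to form K'/K, one to differentiate
    that quotient. *)
Definition hol2 (V : C -> Prop) (K : C -> C) : Prop :=
  exists K1 K2, forall z, V z -> cdiff K z (K1 z) /\ cdiff K1 z (K2 z).

Lemma hol2_cst V c : hol2 V (fun=> c).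
Proof. by exists (fun=> RtoC 0), (fun=> RtoC 0) => z _; split; apply: cdiff_cst. Qed.

Lemma hol2_id V : hol2 V (fun z => z).
Proof.
by exists (fun=> RtoC 1), (fun=> RtoC 0) => z _; split;
  [apply: cdiff_id | apply: cdiff_cst].
Qed.

Lemma hol2_sub V F G : hol2 V F -> hol2 V G -> hol2 V (fun z => F z - G z)%C.
Proof.
move=> [F1 [F2 hF]] [G1 [G2 hG]].
exists (fun z => F1 z - G1 z)%C, (fun z => F2 z - G2 z)%C => z Vz.
by have [? ?] := hF z Vz; have [? ?] := hG z Vz; split; apply: cdiff_sub.
Qed.

Lemma hol2_mul V F G : hol2 V F -> hol2 V G -> hol2 V (fun z => F z * G z)%C.
Proof.
move=> [F1 [F2 hF]] [G1 [G2 hG]].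
eexists (fun z => F1 z * G z + F z * G1 z)%C, _ => z Vz.
have [h1 h2] := hF z Vz; have [h3 h4] := hG z Vz; split.
  exact: cdiff_mul.
exact: cdiff_add (cdiff_mul h2 h3) (cdiff_mul h1 h4).
Qed.

Lemma hol2_inv V F : hol2 V F -> (forall z, V z -> F z <> RtoC 0) ->
  hol2 V (fun z => / F z)%C.
Proof.
move=> [F1 [F2 hF]] h0.
(* Writing the derivative as a product of inverses lets the product rule alone give the second
   derivative. *)
eexists (fun z => (0 - F1 z) * (/ F z * / F z))%C, _ => z Vz.
have [h1 h2] := hF z Vz; have F0 := h0 z Vz; have hI := cdiff_inv h1 F0; split.
  by apply: cdiff_eq hI _; field.
exact: cdiff_mul (cdiff_sub (cdiff_cst _ _) h2) (cdiff_mul hI hI).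
Qed.

Lemma hol2_pow V F n : hol2 V F -> hol2 V (fun z => Cpow (F z) n).
Proof.
by move=> hF; elim: n => [|n IH]; [apply: hol2_cst | apply: hol2_mul].
Qed.

(** Balls of [C] are squares, so each point of one is reached from the centre by a horizontal and
    then a vertical segment inside it. *)
Lemma cdiff_const_near (V : C -> Prop) G z0 : locally z0 V ->
  (forall z, V z -> cdiff G z 0) -> locally z0 (fun z => G z = G z0).
Proof.
move=> [eps hV] hd; exists eps => z hz.
have line (f : R -> R) a x : (forall t, Rabs (t - a) < eps -> rder f t 0) ->
    Rabs (x - a) < eps -> f x = f a.
  move=> h hx; case: (Rtotal_order x a) => [l|[->//|l]].
    apply: eq_is_derive l => t ht; apply: h; move: hx.
    by rewrite !Rabs_left1; lra.
  symmetry; apply: eq_is_derive l => t ht; apply: h; move: hx.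
  by rewrite !Rabs_right; lra.
case: z0 z hV hz => x0 y0 [x y] hV [/= hx hy].
have hh b (w : C) : ball (x0, y0) eps w ->
    cdir G b w 0 by move=> /hV /hd /(_ b) /cder_eq; apply; ring.
have e1 : G (x, y) = G (x, y0).
  apply: injective_projections.
    apply: (line (fun t => Re (G (x, t))) y0 y) => // t ht.
    by have [] := hh true (x, t) (conj hx ht).
  apply: (line (fun t => Im (G (x, t))) y0 y) => // t ht.
  by have [] := hh true (x, t) (conj hx ht).
have hc : ball y0 eps y0 by apply: ball_center.
rewrite e1; apply: injective_projections.
  apply: (line (fun t => Re (G (t, y0))) x0 x) => // t ht.
  by have [] := hh false (t, y0) (conj ht hc).
apply: (line (fun t => Im (G (t, y0))) x0 x) => // t ht.
by have [] := hh false (t, y0) (conj ht hc).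
Qed.

(** * Lifts are conformal *)

Definition partial (b : bool) (f : C -> C) (z : C) : C :=
  (Derive (fun s => Re (f (seg b z s))) (coord b z),
   Derive (fun s => Im (f (seg b z s))) (coord b z)).

Lemma partial_unique b f z d : cdir f b z d -> partial b f z = d.
Proof.
move=> [h1 h2]; apply: injective_projections; exact: is_derive_unique.
Qed.

Lemma smooth_cdir U f b z : smooth_on U f -> U z -> cdir f b z (partial b f z).
Proof.
move=> hf Uz; have [[_ [? [? _]]] [_ [? [? _]]]] := hf z 1%N Uz.
by case: b; split; apply: Derive_correct.
Qed.

Lemma smooth_partial U f b : smooth_on U f -> smooth_on U (partial b f).
Proof.
move=> hf z n Uz; have [[_ [_ [_ [? ?]]]] [_ [_ [_ [? ?]]]]] := hf z n.+1 Uz.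
by case: b; split.
Qed.

Lemma ex_diff_n_opp f n x y : ex_diff_n f n x y ->
  ex_diff_n (fun u v => - f u v) n x y.
Proof.
elim: n f => [|n IH] f /=.
  by move=> [h _]; split => //; apply: continuity_2d_pt_opp.
move=> [h [h1 [h2 [h3 h4]]]]; split; first exact: continuity_2d_pt_opp.
split; first exact: ex_derive_opp.
split; first exact: (ex_derive_opp (f x)).
split.
  apply: ex_diff_n_ext_loc (IH _ h3); apply: locally_2d_forall => u v.
  by rewrite Derive_opp.
apply: ex_diff_n_ext_loc (IH _ h4); apply: locally_2d_forall => u v.
by rewrite (Derive_opp (f u)).
Qed.

Lemma smooth_conj U f : smooth_on U f -> smooth_on U (fun z => Cconj (f z)).
Proof.
by move=> hf z n Uz; have [h1 h2] := hf z n Uz; split => //;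
  apply: ex_diff_n_opp.
Qed.

Lemma smooth_sub (U V : C -> Prop) f :
  (forall z, V z -> U z) -> smooth_on U f -> smooth_on V f.
Proof. by move=> h hf z n /h Uz; apply: hf. Qed.

Lemma partial_conj b f z : partial b (fun w => Cconj (f w)) z = Cconj (partial b f z).
Proof. by rewrite /partial /Cconj /= Derive_opp. Qed.

(** Serves [holo_partial]: the vertical derivative of f' becomes the horizontal derivative of the
    vertical one, to which Cauchy-Riemann applies. *)
Lemma partial_comm U f z : open U -> smooth_on U f -> U z ->
  partial true (partial false f) z = partial false (partial true f) z.
Proof.
move=> oU hf Uz; have hU := oU z Uz; case: z Uz hU => x y Uz hU.
have hV : locally_2d (fun u v => U (u, v)) x y.
  by apply/locally_2d_locally; apply: filter_imp hU => -[].
apply: injective_projections; symmetry; apply: Schwarz.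
- refine (locally_2d_impl _ _ _ _ _ hV); apply: locally_2d_forall => u v Uuv.
  have [[_ [h1 [h2 [[_ [_ [h3 _]]] [_ [h4 _]]]]]] _] := hf (u, v) 2%N Uuv.
  exact: conj h1 (conj h2 (conj h4 h3)).
- by have [[_ [_ [_ [_ [_ [_ [_ [[h _] _]]]]]]]] _] := hf (x, y) 2%N Uz.
- by have [[_ [_ [_ [[_ [_ [_ [_ [h _]]]]] _]]]] _] := hf (x, y) 2%N Uz.
- refine (locally_2d_impl _ _ _ _ _ hV); apply: locally_2d_forall => u v Uuv.
  have [_ [_ [h1 [h2 [[_ [_ [h3 _]]] [_ [h4 _]]]]]]] := hf (u, v) 2%N Uuv.
  exact: conj h1 (conj h2 (conj h4 h3)).
- by have [_ [_ [_ [_ [_ [_ [_ [_ [[h _] _]]]]]]]]] := hf (x, y) 2%N Uz.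
- by have [_ [_ [_ [_ [[_ [_ [_ [_ [h _]]]]] _]]]]] := hf (x, y) 2%N Uz.
Qed.

(** Smoothness is part of the notion, so that f' is again holomorphic by the symmetry of second
    partial derivatives, without Cauchy's integral formula. *)
Definition holo (V : C -> Prop) (f : C -> C) : Prop :=
  [/\ open V, smooth_on V f
    & forall z, V z -> partial true f z = (Ci * partial false f z)%C].

Lemma holo_cdiff V f z : holo V f -> V z -> cdiff f z (partial false f z).
Proof.
move=> [oV hf hCR] Vz [].
  by rewrite -hCR //; apply: smooth_cdir hf Vz.
by rewrite Cmult_1_l; apply: smooth_cdir hf Vz.
Qed.

Lemma holo_partial V f : holo V f -> holo V (partial false f).
Proof.
move=> [oV hf hCR]; split => //; first exact: smooth_partial.
move=> z Vz; rewrite (partial_comm oV hf Vz); apply: partial_unique.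
apply: (@cdir_loc (fun w => Ci * partial false f w)%C).
  by apply: filter_imp (oV z Vz) => w Vw; rewrite hCR.
have h := smooth_cdir false (smooth_partial false hf) Vz.
by apply: cder_eq (cder_mul (cder_cst _ _) h) _; ring.
Qed.

Lemma holo_hol2 V f : holo V f -> hol2 V f.
Proof.
move=> hf; exists (partial false f), (partial false (partial false f)) => z Vz.
by split; apply: holo_cdiff (Vz) => //; apply: holo_partial.
Qed.

(* The coefficient of [dz] in [omega], up to the unit constant [eps]. *)
Definition wcoef (m : nat) (z : C) : C :=
  (/ Cpow z m.+3 * (Cpow z (2 * m + 2)%N - RtoC 1))%C.

Lemma ds2E m z v :
  ds2 m z v = / 4 * (1 + nsq z) ^ 2 * nsq (wcoef m z) * nsq v.
Proof.
rewrite /ds2 /omega -!nsq_Cmod -/(wcoef m z) !(nsq_mul _ v) (nsq_mul (eps m)).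
have -> : nsq (eps m) = 1 by rewrite /eps /nsq; case: odd; rewrite /Re /Im /=; ring.
by ring.
Qed.

Lemma rdiffE f z v :
  rdiff f z v = (partial false f z * RtoC (Re v) + partial true f z * RtoC (Im v))%C.
Proof. by rewrite /rdiff /partial; apply: injective_projections => /=; ring. Qed.

Definition jac (f : C -> C) (z : C) : R :=
  Re (partial false f z) * Im (partial true f z) - Im (partial false f z) * Re (partial true f z).

(** The vectors (1,0), (0,1) and (1,1) show that p and q are orthogonal and of equal length.
    Lagrange's identity then gives J^2 = |p|^4, and the sign of J separates direct from indirect
    similarities. *)
Lemma conformal_dir (k r : R) (p q : C) : 0 < r ->
  (forall v, k * nsq (p * RtoC (Re v) + q * RtoC (Im v))%C = r * nsq v) ->
  let J := Re p * Im q - Im p * Re q in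
  [/\ k * nsq p = r, J <> 0, 0 < J -> q = (Ci * p)%C
    & J < 0 -> q = (- (Ci * p))%C].
Proof.
case: p q => [a b] [c d] r0 h; rewrite /=.
have := h (1, 0); have := h (0, 1); have := h (1, 1).
rewrite /nsq /Re /Im /= => h3 h2 h1.
have e1 : k * (a * a + b * b) = r by rewrite -[RHS]Rmult_1_r; lra.
have e2 : k * (c * c + d * d) = r by rewrite -[RHS]Rmult_1_r; lra.
have k0 : k <> 0 by move=> e; rewrite e in e1; lra.
have e3 : a * c + b * d = 0 by apply: (Rmult_eq_reg_l k) => //; lra.
have e4 : a * a + b * b = c * c + d * d by apply: (Rmult_eq_reg_l k) => //; lra.
have n0 : a * a + b * b <> 0 by move=> e; rewrite e in e1; lra.
have eJ : (a * d - b * c) * (a * d - b * c) =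
    (a * a + b * b) * (a * a + b * b).
  by rewrite {2}e4; have := congr1 (fun t => t * t) e3; rewrite /=; lra.
have nn : 0 < a * a + b * b by nra.
split => //.
  move=> e; have := Rmult_lt_0_compat _ _ nn nn; rewrite -eJ e; lra.
  move=> J0; have eJ' : a * d - b * c = a * a + b * b by apply: Rsqr_inj eJ; lra.
  (* This sum of squares is |p|^2 + |q|^2 - 2 J. *)
  have h0 : (c + b) * (c + b) + (d - a) * (d - a) = 0 by lra.
  have [? ?] := Rplus_sqr_eq_0 _ _ h0.
  by apply: injective_projections => /=; lra.
move=> J0; have eJ' : - (a * d - b * c) = a * a + b * b.
  by apply: Rsqr_inj; rewrite /Rsqr; lra.
have h0 : (c - b) * (c - b) + (d + a) * (d + a) = 0 by lra.
have [? ?] := Rplus_sqr_eq_0 _ _ h0.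
by apply: injective_projections => /=; lra.
Qed.

Lemma wcoef_neq0 m z : 1 < nsq z -> wcoef m z <> RtoC 0.
Proof.
move=> h; have z0 : z <> RtoC 0 by move=> e; move: h; rewrite e /nsq /=; lra.
apply: Cmult_neq_0.
  by move=> e; have := Cinv_r _ (Cpow_nz z m.+3 z0); rewrite e Cmult_0_r;
    move=> /RtoC_inj; lra.
move=> e; have e' : Cpow z (2 * m + 2)%N = RtoC 1.
  by have := congr1 (Cplus^~ (RtoC 1)) e; rewrite /= Cplus_0_l => <-; ring.
have h1 : 1 < Cmod z.
  by move: h; rewrite nsq_Cmod; have := Cmod_ge_0 z; nra.
have := congr1 Cmod e'; rewrite Cmod_pow Cmod_1.
have := Rlt_pow_R1 _ (2 * m + 2)%N h1; rewrite addn2 => /(_ (PeanoNat.Nat.lt_0_succ _)).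
by lra.
Qed.

Lemma continuity_nsq z :
  continuity_2d_pt (fun x y => nsq (x, y)) (Re z) (Im z).
Proof.
apply: continuity_2d_pt_plus; apply: continuity_2d_pt_mult;
  by [apply: continuity_2d_pt_id1 | apply: continuity_2d_pt_id2].
Qed.

Lemma continuity_gt0 (F : C -> R) z :
  continuity_2d_pt (fun x y => F (x, y)) (Re z) (Im z) -> 0 < F z ->
  locally z (fun w => 0 < F w).
Proof.
case: z => x y hF h; have := hF (mkposreal _ h); move/locally_2d_locally.
by apply: filter_imp => -[u v] /= /Rabs_def2; rewrite /Re /Im /=; lra.
Qed.

Lemma nsq_gt1_near z : 1 < nsq z -> locally z (fun w => 1 < nsq w).
Proof.
move=> h; have : 0 < nsq z - 1 by lra.
move/(@continuity_gt0 (fun w => nsq w - 1)) => H; apply: filter_imp (H _).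
  by move=> w; lra.
by apply: continuity_2d_pt_minus (continuity_nsq z) _; apply: continuity_2d_pt_const.
Qed.

Lemma continuity_jac U f z : smooth_on U f -> U z ->
  continuity_2d_pt (fun x y => jac f (x, y)) (Re z) (Im z).
Proof.
move=> hf Uz; have [[h1 _] [h2 _]] := smooth_partial false hf 0%N Uz.
have [[h3 _] [h4 _]] := smooth_partial true hf 0%N Uz.
by apply: continuity_2d_pt_minus; apply: continuity_2d_pt_mult.
Qed.

Lemma wcoef_conj m z : z <> RtoC 0 -> wcoef m (Cconj z) = Cconj (wcoef m z).
Proof.
move=> z0; rewrite /wcoef -!Cpow_conj Cmult_conj Cminus_conj Cinv_conj.
  by congr (_ * (_ - _))%C; apply: injective_projections => //=; ring.
exact: Cpow_nz.
Qed.

Lemma lift_neq0 phi U f z : local_lift phi U f -> U z -> f z <> RtoC 0.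
Proof.
move=> [_ h0 _ h] Uz; have [w [<- _]] := h (@Cstar z (h0 z Uz)) Uz.
exact: cval_neq0.
Qed.

Lemma lift_holo m phi U f z0 : preserves_metric m phi -> local_lift phi U f ->
  U z0 -> 1 < nsq z0 ->
  exists V g, [/\ locally z0 V,
    (forall z, V z -> U z /\ 1 < nsq z), holo V g,
    (forall z, g z = f z) \/ (forall z, g z = Cconj (f z))
    & forall z, V z -> (1 + nsq (g z)) ^ 2 * nsq (wcoef m (g z)) *
        nsq (partial false g z) = (1 + nsq z) ^ 2 * nsq (wcoef m z)].
Proof.
move=> hm hl U0 h0; have [oU _ hf _] := hl.
have conf z : U z -> 1 < nsq z -> [/\
    (1 + nsq (f z)) ^ 2 * nsq (wcoef m (f z)) * nsq (partial false f z) =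
      (1 + nsq z) ^ 2 * nsq (wcoef m z), jac f z <> 0,
    0 < jac f z -> partial true f z = (Ci * partial false f z)%C &
    jac f z < 0 -> partial true f z = (- (Ci * partial false f z))%C].
  move=> Uz hz; apply: conformal_dir.
    apply: Rmult_lt_0_compat; first by have := nsq_ge0 z; nra.
    exact: nsq_gt0 (wcoef_neq0 (m := m) hz).
  by move=> v; have := hm U f hl z v Uz; rewrite !ds2E rdiffE; lra.
have cJ z (Uz : U z) := continuity_jac hf Uz.
(* [s] is the sign of the Jacobian at [z0]; with it both orientations share the rest of the proof.
   Conjugating the value is harmless because [wcoef] has real coefficients. *)
have [s [g [hs hg hg0]]] : exists (s : R) (g : C -> C), [/\ 0 < s * jac f z0,
    (forall z, g z = f z) \/ (forall z, g z = Cconj (f z)),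
    smooth_on U g & forall z, U z -> 1 < nsq z -> 0 < s * jac f z ->
      nsq (g z) = nsq (f z) /\ [/\ nsq (wcoef m (g z)) = nsq (wcoef m (f z)),
      nsq (partial false g z) = nsq (partial false f z) &
      partial true g z = (Ci * partial false g z)%C]].
  have [_ /Rdichotomy [] hJ _ _] := conf z0 U0 h0.
    exists (-1), (fun z => Cconj (f z)); split; [lra|by right|exact: smooth_conj|].
    move=> z Uz hz hj; split; first by rewrite nsq_conj.
    split.
    - rewrite wcoef_conj; first exact: nsq_conj.
      exact: lift_neq0 hl Uz.
    - by rewrite partial_conj nsq_conj.
    rewrite !partial_conj; have [_ _ _ ->] := conf z Uz hz; last by lra.
    by apply: injective_projections => /=; ring.
  exists 1, f; split; [lra|by left|done|].
  by move=> z Uz hz hj; split => //; split => //; have [_ _ ->] := conf z Uz hz => //; lra.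
move=> hG.
pose P z := U z /\ 1 < nsq z /\ 0 < s * jac f z.
(* The interior of [P], which is open by construction; the same device is used again below. *)
exists (fun z => locally z P), g.
have hP z : locally z P -> P z by apply: locally_singleton.
split => //.
- apply: locally_locally; apply: filter_and; first exact: oU.
  apply: filter_and; first exact: nsq_gt1_near.
  apply: (@continuity_gt0 (fun w => s * jac f w)) => //.
  by apply: continuity_2d_pt_mult (cJ _ U0); apply: continuity_2d_pt_const.
- by move=> z /hP [? []].
- split; first by move=> z; apply: locally_locally.
    by apply: smooth_sub hg0 => z /hP [].
  by move=> z /hP [Uz [hz hj]]; have [_ []] := hG z Uz hz hj.
move=> z /hP [Uz [hz hj]]; have [-> [-> -> _]] := hG z Uz hz hj.
by have [] := conf z Uz hz.
Qed.

(** * Invariance of the spherical metric *)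

Lemma nsq1_neq0 z : 1 + nsq z <> 0.
Proof. by have := nsq_ge0 z; lra. Qed.
Arguments nsq1_neq0 : clear implicits.

Lemma rdir_unique G b z l l' : rdir G b z l -> rdir G b z l' -> l = l'.
Proof. exact: rder_unique. Qed.

Lemma cdir_unique G b z l l' : cdir G b z l -> cdir G b z l' -> l = l'.
Proof. exact: cder_unique. Qed.

Lemma rdir_nsq1 g b z d : cdir g b z d ->
  rdir (fun w => 1 + nsq (g w)) b z (2 * Re (Cconj (g z) * d)%C).
Proof.
by move=> h; apply: rder_eq (rder_add (rder_cst 1 _) (rdir_nsq h)) _; ring.
Qed.

(** This is d/dz of log |K|^2 + 2 log (1 + |g|^2) = 2 log (1 + |z|^2). The exponentiated identity is
    differentiated along each axis instead, and divided by itself afterwards. *)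
Lemma log_derivative (V : C -> Prop) g g1 K K1 : open V ->
  (forall z, V z -> cdiff g z (g1 z)) -> (forall z, V z -> cdiff K z (K1 z)) ->
  (forall z, V z -> K z <> RtoC 0) ->
  (forall z, V z -> nsq (K z) * (1 + nsq (g z)) ^ 2 = (1 + nsq z) ^ 2) ->
  forall z, V z -> (K1 z / K z = RtoC (2 / (1 + nsq z)) * Cconj z
    - RtoC (2 / (1 + nsq (g z))) * (Cconj (g z) * g1 z))%C.
Proof.
move=> oV hg hK K0 e z Vz; apply: Cext_dir => b.
have ez := e z Vz; have kz := K0 z Vz.
have u0 := nsq1_neq0 (g z); have v0 := nsq1_neq0 z.
set L := (K1 z / K z)%C; have eL : K1 z = (L * K z)%C by rewrite /L; field.
have hu := rdir_nsq1 (hg z Vz b); have hv := rdir_nsq1 (cdiff_id z b).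
have h1 := rder_mul (rdir_nsq (hK z Vz b)) (rder_mul hu hu).
have {hu hv}h2 := rder_mul hv hv.
have E w : V w -> nsq (K w) * ((1 + nsq (g w)) * (1 + nsq (g w))) =
    (1 + nsq w) * (1 + nsq w).
  by move=> Vw; have := e w Vw; rewrite /= !Rmult_1_r.
have {E} := rdir_unique (rdir_on oV Vz E h1) h2.
rewrite !seg_coord eL => {h1 h2} E.
have n0 := nsq_neq0 kz.
move: ez E u0 v0 n0.
set e1 := axis b.
have -> : Re (Cconj (K z) * (e1 * (L * K z)))%C = nsq (K z) * Re (e1 * L)%C.
  by rewrite /nsq /Re /Im /=; ring.
have -> : Re (e1 * (RtoC (2 / (1 + nsq z)) * Cconj z -
    RtoC (2 / (1 + nsq (g z))) * (Cconj (g z) * g1 z)))%C =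
    2 / (1 + nsq z) * Re (Cconj z * (e1 * RtoC 1))%C -
    2 / (1 + nsq (g z)) * Re (Cconj (g z) * (e1 * g1 z))%C.
  by rewrite /Re /Im /=; ring.
set v := 1 + nsq z; set u := 1 + nsq (g z); set k := nsq (K z).
set A := Re (Cconj z * _)%C; set B := Re (Cconj (g z) * _)%C.
set D := Re (e1 * L)%C => ez E u0 v0 k0.
have eB : k * u * u * (2 * D + 4 * B / u) = 4 * A * v.
  transitivity (2 * A * v + v * (2 * A)); last by ring.
  by rewrite -E; field.
have ev : k * u * u = v * v by move: ez; rewrite /= !Rmult_1_r -Rmult_assoc.
rewrite ev in eB.
have : 2 * D + 4 * B / u = 4 * A / v.
  by apply: (Rmult_eq_reg_l (v * v)); [rewrite eB; field|nra].
by rewrite /Rdiv; lra.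
Qed.

Lemma cdir_scal_inv g b z d (F : C -> C) a : cdir g b z d -> cdir F b z a ->
  cdir (fun w => RtoC (2 / (1 + nsq (g w))) * F w)%C b z
    (RtoC (- 4 * Re (Cconj (g z) * d)%C / ((1 + nsq (g z)) * (1 + nsq (g z)))) * F z
     + RtoC (2 / (1 + nsq (g z))) * a)%C.
Proof.
move=> hg hF; have hu := rdir_nsq1 hg.
have h := rder_mul (rder_cst 2 _) (rder_inv hu (nsq1_neq0 _)).
apply: cder_eq (cder_scal h hF) _; rewrite seg_coord.
by congr (RtoC _ * _ + _)%C; field; apply: nsq1_neq0.
Qed.

Section Isometry.

Variables (V : C -> Prop) (g g1 g2 K : C -> C).
Hypothesis oV : open V.
Hypothesis hg : forall z, V z -> cdiff g z (g1 z).
Hypothesis hg1 : forall z, V z -> cdiff g1 z (g2 z).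
Hypothesis hK : hol2 V K.
Hypothesis K0 : forall z, V z -> K z <> RtoC 0.
Hypothesis eK :
  forall z, V z -> nsq (K z) * (1 + nsq (g z)) ^ 2 = (1 + nsq z) ^ 2.

(* Both sides of the formula for the logarithmic derivative of [K] satisfy the
   Cauchy-Riemann equation; this is the invariance of the curvature. *)
Lemma spherical_isometry z : V z ->
  nsq (g1 z) * (1 + nsq z) ^ 2 = (1 + nsq (g z)) ^ 2.
Proof using oV hg hg1 hK K0 eK.
move=> Vz; have [K1 [K2 hK']] := hK.
have hL := log_derivative oV hg (fun w Vw => (hK' w Vw).1) K0 eK.
have [dK dK1] := hK' z Vz.
have dL := cdiff_mul dK1 (cdiff_inv dK (K0 Vz)).
have dir b := cdir_sub
  (cdir_scal_inv (cdiff_id z b) (cdir_conj (cdiff_id z b)))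
  (cdir_scal_inv (hg Vz b) (cdir_mul (cdir_conj (hg Vz b)) (hg1 Vz b))).
have {}dL b := cdir_unique (cdir_on oV Vz hL (dL b)) (dir b).
have := congr1 (fun w => Ci * w)%C (dL false); rewrite /= Cmult_assoc.
rewrite (_ : Ci * RtoC 1 = Ci)%C; last by ring.
rewrite [LHS](dL true) /=.
have := nsq1_neq0 z; have := nsq1_neq0 (g z).
move: (g z) (g1 z) (g2 z) => [a b] [c d] [p q].
case: z {Vz hL dK dK1 dL dir} => x y.
(* Only the imaginary part carries information: i d/dx - d/dy, applied to the right-hand side of
   [log_derivative], is i times the real number 4 / v^2 - 4 |g1|^2 / u^2, with u and v as set
   below. *)
rewrite /nsq /Re /Im /= => u0 v0 [_ E].
move: E; set v := 1 + (x * x + y * y); set u := 1 + (a * a + b * b) => E.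
have {}E : 4 / (v * v) - 4 * (c * c + d * d) / (u * u) = 0.
  move: E; rewrite -/v -/u; move/Rminus_diag_eq => E; rewrite -[RHS]Ropp_0 -[in RHS]E.
  by rewrite /u /v; field; split.
have : (4 / (v * v) - 4 * (c * c + d * d) / (u * u)) * (v * v * u * u) = 0.
  by rewrite E; ring.
rewrite (_ : _ * (v * v * u * u) = 4 * (u * u) - 4 * (c * c + d * d) * (v * v)).
  by lra.
by field; split.
Qed.

Lemma derivative_neq0 z : V z -> g1 z <> RtoC 0.
Proof using oV hg hg1 hK K0 eK.
move=> Vz e; have := spherical_isometry Vz.
rewrite e /nsq /= => h; have := nsq_ge0 (g z); rewrite /nsq; nra.
Qed.

(** [spherical_isometry] says that 1/g1 satisfies the equation assumed of K, so [log_derivative]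
    applies to it and returns - g2/g1. *)
Lemma second_derivative z : V z -> g2 z = (g1 z *
  (RtoC (2 / (1 + nsq (g z))) * (Cconj (g z) * g1 z)
   - RtoC (2 / (1 + nsq z)) * Cconj z))%C.
Proof using oV hg hg1 hK K0 eK.
move=> Vz; have d0 w (Vw : V w) := derivative_neq0 Vw.
have h := log_derivative oV hg (fun w Vw => cdiff_inv (hg1 Vw) (d0 w Vw)).
have {h} := h _ _ z Vz.
set A := (RtoC _ * (_ * _))%C; set B := (RtoC _ * Cconj z)%C => h.
have -> : (g2 z = - (g1 z * (- g2 z / (g1 z * g1 z) / / g1 z)))%C.
  by field; apply: d0.
rewrite h; first by ring.
  move=> w Vw e; have := Cinv_r _ (d0 w Vw); rewrite e Cmult_0_r.
  by move=> /RtoC_inj; lra.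
move=> w Vw; have n0 := nsq_neq0 (d0 w Vw).
by rewrite -(spherical_isometry Vw) nsq_inv; [field | apply: d0].
Qed.

(** [t] is the height of g z, and [q] is its Wirtinger derivative dt/dz, written with nested factors
    2 / (1 + |g|^2) so that [cdir_scal_inv] differentiates it. *)
Let t z := 1 - 2 / (1 + nsq (g z)).
Let q z := (RtoC (2 / (1 + nsq (g z))) *
            (RtoC (2 / (1 + nsq (g z))) * (RtoC (/ 2) * (g1 z * Cconj (g z)))))%C.

Lemma rdir_height b z : V z -> rdir t b z (2 * Re (axis b * q z)%C).
Proof using hg.
move=> Vz; have hu := rdir_nsq1 (hg Vz b).
have h := rder_mul (rder_cst 2 _) (rder_inv hu (nsq1_neq0 _)).
apply: rder_eq (rder_sub (rder_cst 1 _) h) _; rewrite /q seg_coord.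
have := nsq1_neq0 (g z); set u := 1 + _ => u0.
by rewrite /Re /Im /=; field.
Qed.

(* The Hessian equation of a linear function on the unit sphere. *)
Lemma cdir_height b z : V z -> cdir q b z
  (- (RtoC (2 / (1 + nsq z)) * (axis b * Cconj z * q z))
   - RtoC (2 * t z / ((1 + nsq z) * (1 + nsq z))) * Cconj (axis b))%C.
Proof using oV hg hg1 hK K0 eK.
move=> Vz; have h0 := cdir_mul (cdir_cst (RtoC (/ 2)) _ _)
  (cdir_mul (hg1 Vz b) (cdir_conj (hg Vz b))).
have h := cdir_scal_inv (hg Vz b) (cdir_scal_inv (hg Vz b) h0).
apply: cder_eq h _; rewrite (second_derivative Vz) /q /t.
have := spherical_isometry Vz.
have := nsq1_neq0 z; have := nsq1_neq0 (g z).
move=> u0 v0 eS.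
(* Once 1 / (1 + |z|^2)^2 is traded for |g1|^2 / (1 + |g|^2)^2, the claim is a rational identity in
   which 1 + |z|^2 may be treated as an independent variable. *)
have {}eS : / ((1 + nsq z) * (1 + nsq z)) =
    nsq (g1 z) / ((1 + nsq (g z)) * (1 + nsq (g z))).
  apply: (Rmult_eq_reg_r ((1 + nsq z) ^ 2 * (1 + nsq (g z)) ^ 2)).
    transitivity ((1 + nsq (g z)) ^ 2); first by field.
    by rewrite -{1}eS; field.
  by apply: Rmult_integral_contrapositive; split; apply: pow_nonzero.
rewrite /Rdiv eS.
move: (g z) (g1 z) u0 => [a1 b1] [c d] u0.
case: z v0 {Vz h0 eS} => x y v0; case: (axis b) => e f; move: (1 + nsq (x, y)) v0 => v v0.
rewrite /nsq /Re /Im /= in u0 *.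
by apply: injective_projections; rewrite /=; field; split.
Qed.

(** Suppose t (1 + |z|^2) = c (|z|^2 - 1) + 2 Re (d z) with constants c, d. Differentiating by z
    gives d = [del c z], and eliminating d gives c = [gam z]. The next two lemmas show that these
    expressions are indeed constant. *)
Let gam z := 2 * Re (q z * z)%C + t z * (1 - 2 / (1 + nsq z)).
Let del c z := (RtoC (1 + nsq z) * q z + RtoC (t z - c) * Cconj z)%C.

Lemma rdir_gam b z : V z -> rdir gam b z 0.
Proof using oV hg hg1 hK K0 eK.
move=> Vz; have hq := (cdir_mul (cdir_height b Vz) (cdiff_id z b)).1.
have hv := rder_inv (rdir_nsq1 (cdiff_id z b)) (nsq1_neq0 _).
have := rder_add (rder_mul (rder_cst 2 _) hq)
  (rder_mul (rdir_height b Vz) (rder_sub (rder_cst 1 _) (rder_mul (rder_cst 2 _) hv))).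
move/rder_eq; apply; rewrite seg_coord.
have := nsq1_neq0 z; case: (q z) (t z) => q1 q2 t0.
case: z {Vz hq hv} => x y; case: (axis b) => e f.
rewrite /nsq /Re /Im /= => v0.
by field.
Qed.

Lemma cdir_del b c z : V z -> c = gam z -> cdir (del c) b z (RtoC 0).
Proof using oV hg hg1 hK K0 eK.
move=> Vz ec; have hv := rdir_nsq1 (cdiff_id z b).
have ht := rder_sub (rdir_height b Vz) (rder_cst c _).
have h1 := cder_scal hv (cdir_height b Vz).
have h2 := cder_scal ht (cdir_conj (cdiff_id z b)).
apply: cder_eq (cder_add h1 h2) _; rewrite !seg_coord ec /gam.
have := nsq1_neq0 z; case: (q z) (t z) => q1 q2 t0.
case: z {Vz hv ht h1 h2 ec} => x y; case: (axis b) => e f.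
rewrite /nsq /Re /Im /= => v0.
by apply: injective_projections; rewrite /=; field.
Qed.

Lemma height_linear z0 : V z0 -> exists (c : R) (d : C), c * c + nsq d = 1 /\
  locally z0 (fun z => (1 - 2 / (1 + nsq (g z))) * (1 + nsq z) =
    c * (nsq z - 1) + 2 * Re (d * z)%C).
Proof using oV hg hg1 hK K0 eK.
move=> V0; pose c := gam z0; exists c, (del c z0); split.
  (* On the unit sphere the gradient of the height has squared length 1 - height^2; an isometry
     transports this to [t]. It makes (c, d) a unit vector. *)
  have eq : nsq (q z0) * (1 + nsq z0) ^ 2 = 1 - t z0 * t z0.
    have u0 := nsq1_neq0 (g z0); rewrite /q !nsq_mul nsq_conj.
    transitivity (nsq (g1 z0) * (1 + nsq z0) ^ 2 * 4 * nsq (g z0) /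
        (1 + nsq (g z0)) ^ 4).
      have nR r : nsq (RtoC r) = r * r by rewrite /nsq /Re /Im /=; ring.
      by rewrite !nR; field.
    by rewrite spherical_isometry // /t; field.
  have := nsq1_neq0 z0; move: eq; rewrite /c /gam /del.
  case: (q z0) (t z0) => q1 q2 t0; case: (z0) => x y.
  rewrite /nsq /Re /Im /= => eq v0.
  set v := 1 + (x * x + y * y) in eq v0 *.
  set A := q1 * x - q2 * y.
  have ev : x * x + y * y = v - 1 by rewrite /v; ring.
  transitivity ((q1 * q1 + q2 * q2) * (v * (v * 1)) + t0 * t0); last by rewrite eq; ring.
  rewrite /A /v; field.
  exact: v0.
have h1 : locally z0 (fun z => RtoC (gam z) = RtoC (gam z0)).
  apply: (@cdiff_const_near V) => [|z Vz b]; first exact: oV.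
  rewrite Cmult_0_r; split; [exact: rdir_gam | exact: rder_cst].
have h2 : locally z0 (fun z => V z /\ gam z = c).
  by apply: filter_and (oV V0) _; apply: filter_imp h1 => z /RtoC_inj.
have h3 : locally z0 (fun z => del c z = del c z0).
  apply: (@cdiff_const_near _ _ _ h2) => z [Vz ez] b.
  by rewrite Cmult_0_r; apply: cdir_del.
apply: filter_imp (filter_and _ _ h2 h3) => z [[_ ec] <-]; rewrite -ec.
have := nsq1_neq0 z; rewrite /gam /del -/(t z).
case: (q z) (t z) => q1 q2 t0; case: (z) => x y.
by rewrite /nsq /Re /Im /= => v0; field.
Qed.

End Isometry.

(** * The quotient and the exterior of the unit disc *)

Lemma cls_eq z w : cls z = cls w <-> w = z \/ w = antipode z.
Proof.
split=> [/(congr1 (fun S : Hquot => sval S w)) /= e|].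
  by suff: Defs.orbit z w by []; rewrite e; left.
move=> h; suff e : Defs.orbit z = Defs.orbit w.
  apply: eq_exist_uncurried; exists e; exact: proof_irrelevance.
apply: functional_extensionality => t; apply: propositional_extensionality.
by case: h => ->; rewrite /Defs.orbit ?antipodeK; tauto.
Qed.

Lemma cls_antipode z : cls (antipode z) = cls z.
Proof. by apply/cls_eq; right; rewrite antipodeK. Qed.

Lemma cls_surj (S : Hquot) : exists z, S = cls z.
Proof.
case: S => S [z e]; exists z; subst S.
by congr exist; apply: proof_irrelevance.
Qed.

Lemma nsq_cstar (z : cstar) : 0 < nsq z.
Proof. exact: nsq_gt0 (@cval_neq0 z). Qed.

Lemma nsq_antipode z : nsq (antipode z) = / nsq z.
Proof.
have z0 := @cval_neq0 z; rewrite /= /Cdiv nsq_mul nsq_inv ?nsq_conj.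
  by rewrite {1}/nsq /Re /Im /=; ring.
by move=> h; apply: z0; apply: nsq_eq0; rewrite -nsq_conj h /nsq /=; ring.
Qed.

Definition rcont (D : C -> R) (z : C) : Prop :=
  continuity_2d_pt (fun x y => D (x, y)) (Re z) (Im z).

Lemma rcont_cst c z : rcont (fun=> c) z.
Proof. exact: continuity_2d_pt_const. Qed.

Lemma rcont_add D E z : rcont D z -> rcont E z -> rcont (fun w => D w + E w) z.
Proof. exact: continuity_2d_pt_plus. Qed.

Lemma rcont_sub D E z : rcont D z -> rcont E z -> rcont (fun w => D w - E w) z.
Proof. exact: continuity_2d_pt_minus. Qed.

Lemma rcont_opp D z : rcont D z -> rcont (fun w => - D w) z.
Proof. exact: continuity_2d_pt_opp. Qed.

Lemma rcont_mul D E z : rcont D z -> rcont E z -> rcont (fun w => D w * E w) z.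
Proof. exact: continuity_2d_pt_mult. Qed.

Lemma rcont_inv D z : rcont D z -> D z <> 0 -> rcont (fun w => / D w) z.
Proof. by move=> h h0; apply: continuity_2d_pt_inv => //; case: (z) h0. Qed.

Lemma rcont_Re z : rcont Re z.
Proof. exact: continuity_2d_pt_id1. Qed.

Lemma rcont_Im z : rcont Im z.
Proof. exact: continuity_2d_pt_id2. Qed.

Lemma rcont_nsq z : rcont nsq z.
Proof. exact: continuity_nsq. Qed.

Lemma rcont_nsq_comp (f : C -> C) z : rcont (fun w => Re (f w)) z ->
  rcont (fun w => Im (f w)) z -> rcont (fun w => nsq (f w)) z.
Proof. by move=> h1 h2; apply: rcont_add; apply: rcont_mul. Qed.

Lemma smooth_rcont U f z : smooth_on U f -> U z ->
  rcont (fun w => Re (f w)) z /\ rcont (fun w => Im (f w)) z.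
Proof. by move=> hf Uz; have [[? _] [? _]] := hf z 0%N Uz. Qed.

Lemma rcont_neq0 D z : rcont D z -> D z <> 0 -> locally z (fun w => D w <> 0).
Proof.
move=> h h0; have h2 := rcont_mul h h.
have h3 := @continuity_gt0 (fun w => D w * D w) z h2 (Rsqr_pos_lt _ h0).
by apply: filter_imp h3 => w hw e; move: hw; rewrite e; lra.
Qed.

(** A radial push by the factor 1 + k leaves the closed disc; [M] exceeds |x| and |y|, so k = eps /
    M moves each coordinate by less than eps. *)
Lemma locally_outside (P : C -> Prop) z : 1 <= nsq z -> locally z P ->
  exists w, 1 < nsq w /\ P w.
Proof.
case: z => x y hz [eps h]; pose M := 1 + Rabs x + Rabs y.
have ax := Rabs_pos x; have ay := Rabs_pos y; have e0 := cond_pos eps.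
have M0 : 0 < M by rewrite /M; lra.
pose k := eps / M; have k0 : 0 < k by apply: Rdiv_lt_0_compat.
have ek : k * M = eps by rewrite /k; field; lra.
exists ((1 + k) * x, (1 + k) * y); split.
  move: hz; rewrite /nsq /Re /Im /= => hz.
  have : 1 * (x * x + y * y) < (1 + k) * (1 + k) * (x * x + y * y).
    by apply: Rmult_lt_compat_r; nra.
  by lra.
apply: h; split; rewrite /= /ball /= /AbsRing_ball /abs /minus /plus /opp /=.
  rewrite (_ : _ + _ = k * x); last by ring.
  by rewrite Rabs_mult Rabs_pos_eq; [rewrite -ek /M; nra|lra].
rewrite (_ : _ + _ = k * y); last by ring.
by rewrite Rabs_mult Rabs_pos_eq; [rewrite -ek /M; nra|lra].
Qed.

Lemma closure_outside D z : 1 <= nsq z -> rcont D z ->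
  locally z (fun w => 1 < nsq w -> D w = 0) -> D z = 0.
Proof.
move=> hz hD h; case: (Req_dec (D z) 0) => // /(rcont_neq0 hD) hn.
by have [w [hw [/(_ hw) e]]] := locally_outside hz (filter_and _ _ h hn).
Qed.

(* Polar segments stay in the region [1 < nsq z]. *)
Lemma connected_outside (P : C -> Prop) :
  (forall z, 1 < nsq z -> locally z P \/ locally z (fun w => ~ P w)) ->
  forall z w, 1 < nsq z -> 1 < nsq w -> P z -> P w.
Proof.
move=> hP z w hz hw Pz.
have nz0 x : 1 < nsq x -> x <> RtoC 0.
  by move=> h e; move: h; rewrite e /nsq /=; lra.
pose z' := @Cstar z (nz0 z hz); pose w' := @Cstar w (nz0 w hw).
have [ez ew] := (congr1 cval (modulus_argE z'), congr1 cval (modulus_argE w')).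
have gt1 (x : cstar) : 1 < nsq x -> 1 < modulus x.
  by rewrite nsq_Cmod /=; have := Cmod_ge_0 x; nra.
have r0 := gt1 z' hz; have r1 := gt1 w' hw.
move: ez ew r0 r1; rewrite /polar /=.
set r := Cmod z; set r' := Cmod w; set a := arg z'; set b := arg w'.
move=> ez ew r0 r1.
pose p s : C := ((r + s * (r' - r)) * cos (a + s * (b - a)),
                 (r + s * (r' - r)) * sin (a + s * (b - a))).
have p0 : p 0 = z by rewrite -ez /p /expi; apply: injective_projections;
  rewrite /= !Rmult_0_l !Rplus_0_r; ring.
have p1 : p 1 = w.
  rewrite -ew /p /expi; apply: injective_projections;
  by rewrite /= (_ : a + _ = b); ring.
have hp s : 0 <= s <= 1 -> 1 < nsq (p s).
  move=> hs; rewrite /nsq /p /Re /Im /=.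
  set c := cos _; set d := sin _; set R0 := r + _.
  have -> : R0 * c * (R0 * c) + R0 * d * (R0 * d) = R0 * R0.
    have e := sin2_cos2 (a + s * (b - a)); rewrite -[RHS]Rmult_1_r -e /Rsqr -/c -/d.
    by ring.
  have h : R0 = (1 - s) * r + s * r' by rewrite /R0; ring.
  have h1 := Rmult_le_pos (1 - s) (r - 1); have h2 := Rmult_le_pos s (r' - 1).
  have : 1 < R0 by rewrite h; case: (Rle_lt_dec s (1 / 2)) => ?; nra.
  by nra.
have cp s (Q : C -> Prop) : locally (p s) Q -> locally s (fun t => Q (p t)).
  move=> [eps h].
  have c1 : continuous (fun t => (r + t * (r' - r)) * cos (a + t * (b - a))) s.
    have e : ex_derive (fun t => (r + t * (r' - r)) * cos (a + t * (b - a))) s.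
      by auto_derive.
    exact: ex_derive_continuous e.
  have c2 : continuous (fun t => (r + t * (r' - r)) * sin (a + t * (b - a))) s.
    have e : ex_derive (fun t => (r + t * (r' - r)) * sin (a + t * (b - a))) s.
      by auto_derive.
    exact: ex_derive_continuous e.
  have h1 : locally s (fun t => ball (p s).1 eps (p t).1).
    exact: c1 _ (locally_ball _ eps).
  have h2 : locally s (fun t => ball (p s).2 eps (p t).2).
    exact: c2 _ (locally_ball _ eps).
  by apply: filter_imp (filter_and _ _ h1 h2) => t [? ?]; apply: h.
(* Connectedness of [0, 1] in the form of calculus: this indicator is locally constant, so its
   derivative vanishes and it takes the same value at both ends. *)
pose chi s : R := if excluded_middle_informative (P (p s)) then 1 else 0.
have : chi 0 = chi 1.
  apply: eq_is_derive; last by lra.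
  move=> s hs; case: (hP (p s) (hp s hs)) => /[dup] /locally_singleton h0 /cp h.
    apply: (is_derive_ext_loc (fun=> 1)); last exact: is_derive_const.
    by apply: filter_imp h => t h; rewrite /chi; case: excluded_middle_informative.
  apply: (is_derive_ext_loc (fun=> 0)); last exact: is_derive_const.
  by apply: filter_imp h => t h; rewrite /chi; case: excluded_middle_informative.
rewrite /chi p0 p1; destruct (excluded_middle_informative (P z)) => //.
by destruct (excluded_middle_informative (P w)) => //= ?; lra.
Qed.

(** The difference of the squares is a quartic in s; it vanishes at the five points 0, k, -k, 2k,
    -2k of the interval, which kills its coefficients c0, ..., c4. *)
Lemma quadratic_sq_eq (a b c a' b' c' : R) (eps : posreal) :
  (forall s, Rabs s < eps ->
    (a + b * s + c * (s * s)) ^ 2 = (a' + b' * s + c' * (s * s)) ^ 2) ->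
  (a + b + c) ^ 2 = (a' + b' + c') ^ 2.
Proof.
move=> h; pose k := eps / 3; have e0 := cond_pos eps.
have k0 : 0 < k by rewrite /k; lra.
have {}h s : Rabs s <= 2 * k -> (a + b * s + c * (s * s)) ^ 2 =
    (a' + b' * s + c' * (s * s)) ^ 2.
  by move=> hs; apply: h; move: hs; rewrite /k; lra.
have hr s : 0 <= s <= 2 * k -> Rabs s <= 2 * k /\ Rabs (- s) <= 2 * k.
  by move=> hs; rewrite Rabs_Ropp Rabs_pos_eq; lra.
have [/h h0 _] := hr 0 ltac:(lra); have [/h h1 /h h2] := hr k ltac:(lra).
have [/h h3 /h h4] := hr (2 * k) ltac:(lra).
pose c0 := a * a - a' * a'; pose c1 := 2 * (a * b - a' * b').
pose c2 := b * b + 2 * a * c - (b' * b' + 2 * a' * c').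
pose c3 := 2 * (b * c - b' * c'); pose c4 := c * c - c' * c'.
have z0 : c0 = 0 by rewrite /c0; lra.
have cz x : k * x = 0 -> x = 0 by move=> e; apply: (Rmult_eq_reg_l k); lra.
have z4 : c4 = 0.
  by do 4 apply: (cz); rewrite /c4; rewrite /c0 in z0; lra.
have z2 : c2 = 0.
  by do 2 apply: (cz); have := congr1 (fun t => k * k * k * k * t) z4;
    rewrite /c2 /c4; rewrite /c0 in z0; lra.
have z3 : c3 = 0 by do 3 apply: (cz); rewrite /c3; lra.
have z1 : c1 = 0.
  by apply: (cz); have := congr1 (fun t => k * k * k * t) z3; rewrite /c1 /c3; lra.
have : (a + b + c) ^ 2 - (a' + b' + c') ^ 2 = c0 + c1 + c2 + c3 + c4.
  by rewrite /c0 /c1 /c2 /c3 /c4; ring.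
by lra.
Qed.

(** In stereographic coordinates, 1 + |z|^2 times the linear function c x3 + Re (d (x1 + i x2)).
    Clearing the denominator makes it a polynomial in the coordinates of z. *)
Definition sphere_lin (c : R) (d z : C) : R := c * (nsq z - 1) + 2 * Re (d * z)%C.

(** On the line from [z0] to the target both functions are quadratic in the parameter, so
    [quadratic_sq_eq] carries the equality of squares from parameters near 0 to the parameter 1. *)
Lemma sphere_lin_sq_unique c d c' d' z0 :
  locally z0 (fun z => sphere_lin c d z ^ 2 = sphere_lin c' d' z ^ 2) ->
  forall z, sphere_lin c d z ^ 2 = sphere_lin c' d' z ^ 2.
Proof.
case: z0 => x0 y0 [eps h] [x y].
pose M := 1 + Rabs (x - x0) + Rabs (y - y0); have e0 := cond_pos eps.
have ax := Rabs_pos (x - x0); have ay := Rabs_pos (y - y0).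
have M0 : 0 < M by rewrite /M; lra.
have k0 : 0 < eps / M by apply: Rdiv_lt_0_compat.
pose dz : C := (x - x0, y - y0).
have E (c1 : R) (d1 : C) s : sphere_lin c1 d1 (x0 + s * (x - x0), y0 + s * (y - y0)) =
    sphere_lin c1 d1 (x0, y0) +
    (2 * (c1 * (x0 * (x - x0) + y0 * (y - y0)))
      + 2 * Re (d1 * dz)%C) * s
    + c1 * ((x - x0) * (x - x0) + (y - y0) * (y - y0)) * (s * s).
  by case: d1 => p q; rewrite /sphere_lin /nsq /dz /Re /Im /=; ring.
have := E c d 1; have := E c' d' 1; rewrite !Rmult_1_l !Rmult_1_r.
rewrite (_ : (_, _) = (x, y)); last by congr pair; ring.
move=> -> ->; apply: (quadratic_sq_eq (eps := mkposreal _ k0)) => s /= hs.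
rewrite -!E; apply: h.
have hs' : Rabs s * M < eps.
  have := Rmult_lt_compat_r _ _ _ M0 hs.
  by rewrite (_ : eps / M * M = eps) //; field; lra.
have as0 := Rabs_pos s.
split; rewrite /= /ball /= /AbsRing_ball /abs /minus /plus /opp /=.
  rewrite (_ : _ + _ = s * (x - x0)); last by ring.
  by rewrite Rabs_mult; rewrite /M in hs'; nra.
rewrite (_ : _ + _ = s * (y - y0)); last by ring.
by rewrite Rabs_mult; rewrite /M in hs'; nra.
Qed.

(** * Isometries preserve the modulus up to inversion *)

Lemma hol2_wcoef m V g : hol2 V g -> (forall z, V z -> g z <> RtoC 0) ->
  hol2 V (fun z => wcoef m (g z)).
Proof.
move=> hg g0; apply: hol2_mul; last first.
  by apply: hol2_sub; [apply: hol2_pow | apply: hol2_cst].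
by apply: hol2_inv => [|z Vz]; [apply: hol2_pow | apply: Cpow_nz; apply: g0].
Qed.

(* Third stereographic coordinate. *)
Definition height (z : C) : R := 1 - 2 / (1 + nsq z).

Lemma height_antipode w : height (antipode w) = - height w.
Proof.
rewrite /height nsq_antipode; have := nsq_cstar w => h.
by field; split; lra.
Qed.

Lemma lift_local m phi U f z0 : preserves_metric m phi -> local_lift phi U f ->
  U z0 -> 1 < nsq z0 ->
  exists V g, [/\ locally z0 V,
    (forall z, V z -> U z /\ 1 < nsq z), holo V g,
    (forall z, g z = f z) \/ (forall z, g z = Cconj (f z)) &
    [/\ forall z, V z -> (1 + nsq (g z)) ^ 2 * nsq (wcoef m (g z)) *
        nsq (partial false g z) = (1 + nsq z) ^ 2 * nsq (wcoef m z),
      forall z, V z ->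
        nsq (partial false g z) * (1 + nsq z) ^ 2 = (1 + nsq (g z)) ^ 2
    & exists c d, c * c + nsq d = 1 /\
        locally z0 (fun z => height (g z) * (1 + nsq z) = sphere_lin c d z)]].
Proof.
move=> hm hl U0 h0.
have [V [g [V0 VU hg gf eg]]] := lift_holo hm hl U0 h0.
have [oV _ _] := hg.
have g0 z : V z -> g z <> RtoC 0.
  move=> Vz; have fz := lift_neq0 hl (VU z Vz).1; case: gf => -> // e.
  by apply: fz; apply: nsq_eq0; rewrite -nsq_conj e /nsq /Re /Im /=; ring.
have z0' z : V z -> z <> RtoC 0.
  by move=> /VU [Uz _]; case: hl => _ h _ _; apply: h.
have w0 z : V z -> wcoef m z <> RtoC 0 by move=> /VU [_ hz]; apply: wcoef_neq0.
pose K z := (wcoef m (g z) * partial false g z * / wcoef m z)%C.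
have hK : hol2 V K.
  apply: hol2_mul.
    apply: hol2_mul; last exact: holo_hol2 (holo_partial hg).
    exact: hol2_wcoef (holo_hol2 hg) g0.
  apply: (hol2_inv _ w0); exact: hol2_wcoef (hol2_id V) z0'.
have eK z : V z -> nsq (K z) * (1 + nsq (g z)) ^ 2 = (1 + nsq z) ^ 2.
  move=> Vz; have n0 := nsq_neq0 (w0 z Vz).
  rewrite /K (nsq_mul _ (/ wcoef m z)%C) (nsq_mul (wcoef m (g z))).
  rewrite (nsq_inv (w0 z Vz)).
  by apply: (Rmult_eq_reg_r (nsq (wcoef m z))) => //; rewrite -eg //; field.
(* This also shows that [g] takes no branch point as a value: the metric is not degenerate at z,
   hence not at g z. *)
have K0 z : V z -> K z <> RtoC 0.
  move=> Vz e; have := eK z Vz; rewrite e {1}/nsq /Re /Im /=.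
  by have := nsq_ge0 z; nra.
have h1 z (Vz : V z) := holo_cdiff hg Vz.
have h2 z (Vz : V z) := holo_cdiff (holo_partial hg) Vz.
exists V, g; split => //; split => //.
  by move=> z Vz; apply: (spherical_isometry oV h1 h2 hK K0 eK).
exact: height_linear oV h1 h2 hK K0 eK z0 (locally_singleton _ _ V0).
Qed.

(* The antipode only changes the sign of the height, so the square descends. *)
Definition height_on (phi : Hquot -> Hquot) (c : R) (d z : C) : Prop :=
  forall z' w : cstar, cval z' = z -> phi (cls z') = cls w ->
    (height w * (1 + nsq z)) ^ 2 = sphere_lin c d z ^ 2.

Lemma lift_height phi U f (z w : cstar) : local_lift phi U f -> U z ->
  phi (cls z) = cls w -> height (f z) ^ 2 = height w ^ 2.
Proof.
move=> [_ _ _ h] Uz e; have [w' [<- e']] := h z Uz.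
have /cls_eq [->|->] // : cls w' = cls w by rewrite -e'.
by rewrite height_antipode; ring.
Qed.

Lemma height_conj z : height (Cconj z) = height z.
Proof. by rewrite /height nsq_conj. Qed.

Lemma image_height m phi z0 : preserves_metric m phi -> smooth_quot phi ->
  1 < nsq z0 -> exists c d, c * c + nsq d = 1 /\ locally z0 (height_on phi c d).
Proof.
move=> hm hs h0; have n0 : z0 <> RtoC 0.
  by move=> e; move: h0; rewrite e /nsq /Re /Im /=; lra.
have [U [f [U0 hl]]] := hs (Cstar n0).
have [V [g [V0 VU _ gf [_ _ [c [d [hcd h]]]]]]] := lift_local hm hl U0 h0.
exists c, d; split => //.
apply: filter_imp (filter_and _ _ V0 h) => z [Vz el] z' w ez ew.
have [Uz _] := VU z Vz; rewrite -el.
rewrite !Rpow_mult_distr; congr (_ * _).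
have <- : height (f z) ^ 2 = height w ^ 2.
  by rewrite -ez in Uz *; apply: lift_height hl Uz ew.
by case: gf => ->; rewrite ?height_conj.
Qed.

Lemma rcont_sphere_lin c d z : rcont (sphere_lin c d) z.
Proof.
apply: rcont_add; apply: rcont_mul; try exact: rcont_cst.
  by apply: rcont_sub (rcont_cst _ _); apply: rcont_nsq.
apply: rcont_sub; apply: rcont_mul (rcont_cst _ _) _.
  exact: rcont_Re.
exact: rcont_Im.
Qed.

Lemma global_height m phi : preserves_metric m phi -> smooth_quot phi ->
  exists c d, [/\ 0 <= c, c * c + nsq d = 1 &
    forall z, 1 <= nsq z -> height_on phi c d z].
Proof.
move=> hm hs; pose zb : C := (2, 0).
have hb : 1 < nsq zb by rewrite /nsq /Re /Im /=; lra.
(* (c, d) and (-c, -d) have the same square. The choice [0 <= c] later puts the maximum of the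
   linear function outside the open unit disc. *)
have [c [d [c0 [hcd h]]]] : exists c d, 0 <= c /\ c * c + nsq d = 1 /\
    locally zb (height_on phi c d).
  have [c [d [hcd h]]] := image_height hm hs hb.
  case: (Rle_lt_dec 0 c) => hc; first by exists c, d.
  exists (- c), (- d)%C; split; first by lra.
  split; first by rewrite -hcd /nsq /Re /Im /=; ring.
  apply: filter_imp h => z h z' w ez ew; rewrite (h z' w ez ew).
  by rewrite /sphere_lin /Re /Im /=; ring.
exists c, d; split => //.
have {h}hout z : 1 < nsq z -> locally z (height_on phi c d).
  move=> hz; apply: (@connected_outside (fun z => locally z (height_on phi c d)))
    (hb) (hz) (h) => {z hz} z hz.
  have [c' [d' [_ h']]] := image_height hm hs hz.
  case: (excluded_middle_informative (forall z, sphere_lin c d z ^ 2 = sphere_lin c' d' z ^ 2)).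
    move=> e; left; apply: locally_locally; apply: filter_imp h' => x h' z' w ez ew.
    by rewrite e; apply: h' ez ew.
  (* If the property held at points arbitrarily close by, both forms would have equal squares on an
     open set, hence everywhere. *)
  move=> ne; right.
  have hn : locally z (fun x => locally x (fun t => height_on phi c' d' t /\ 1 < nsq t)).
    by apply: locally_locally; apply: filter_and => //; apply: nsq_gt1_near.
  apply: filter_imp hn => x hx hx'; apply: ne.
  apply: (@sphere_lin_sq_unique _ _ _ _ x).
  apply: filter_imp (filter_and _ _ hx hx') => t [[h1 ht] h2].
  have t0 : t <> RtoC 0 by move=> e; move: ht; rewrite e /nsq /Re /Im /=; lra.
  have [w ew] := cls_surj (phi (cls (Cstar t0))).
  by rewrite -(h1 (Cstar t0) w erefl ew) -(h2 (Cstar t0) w erefl ew).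
move=> z hz z' w ez ew.
(* It remains to include the unit circle: a continuous lift carries the identity over from
   outside. *)
have [U [f [U0 hl]]] := hs z'.
have [oU _ hf _] := hl.
have fz := lift_height hl U0 ew.
rewrite Rpow_mult_distr -fz -ez -Rpow_mult_distr.
apply: Rminus_diag_uniq; rewrite -ez in hz.
apply: (@closure_outside (fun x => (height (f x) * (1 + nsq x)) ^ 2 - sphere_lin c d x ^ 2) z') => //.
  have [cf1 cf2] := smooth_rcont hf U0.
  have cn x : rcont (fun t => 1 + nsq t) x.
    by apply: rcont_add (rcont_cst _ _) _; apply: rcont_nsq.
  have sq D x : rcont D x -> rcont (fun t => D t ^ 2) x.
    by move=> h; apply: rcont_mul => //; apply: rcont_mul (rcont_cst _ _).
  apply: rcont_sub; apply: sq; last exact: rcont_sphere_lin.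
  apply: rcont_mul => //; apply: rcont_sub (rcont_cst _ _) _.
  apply: rcont_mul (rcont_cst _ _) _; apply: rcont_inv.
    by apply: rcont_add (rcont_cst _ _) _; apply: rcont_nsq_comp.
  exact: nsq1_neq0.
apply: filter_imp (oU _ U0) => x Ux hx.
have x0 : x <> RtoC 0 by move=> e; move: hx; rewrite e /nsq /Re /Im /=; lra.
have [v ev] := cls_surj (phi (cls (Cstar x0))).
rewrite Rpow_mult_distr (lift_height (z := Cstar x0) hl Ux ev).
by rewrite -Rpow_mult_distr (locally_singleton _ _ (hout x hx) (Cstar x0) v erefl ev); ring.
Qed.

Lemma height_lt1 (w : cstar) : height w ^ 2 < 1.
Proof.
have h := nsq_cstar w; rewrite /height.
have : 0 < / (1 + nsq w) < 1.
  split; first by apply: Rinv_0_lt_compat; lra.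
  by rewrite -Rinv_1; apply: Rinv_lt_contravar; lra.
by rewrite /Rdiv; nra.
Qed.

Lemma modulus_preserved m phi (z w : cstar) :
  preserves_metric m phi -> smooth_quot phi -> 1 <= nsq z ->
  phi (cls z) = cls w -> nsq w = nsq z \/ nsq w = / nsq z.
Proof.
move=> hm hs hz ew; have [c [d [c0 hcd h]]] := global_height hm hs.
have d0 : d = RtoC 0.
  case: (Req_dec (nsq d) 0) => [/nsq_eq0 //|nd].
  have nd0 : 0 < nsq d by have := nsq_ge0 d; lra.
  have c1 : c < 1 by nra.
  (* The stereographic image of the unit vector (Re d, - Im d, c), where the linear function attains
     its maximum 1. The image of [p] would then have height 1 or -1, which no point of [cstar]
     has. *)
  pose p : C := (RtoC (/ (1 - c)) * Cconj d)%C.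
  have ep : nsq p = (1 + c) / (1 - c).
    rewrite /p nsq_mul nsq_conj (_ : nsq d = (1 - c) * (1 + c)); last by lra.
    by rewrite /nsq /Re /Im /=; field; lra.
  have hp : 1 <= nsq p.
    by rewrite ep; apply/Rle_div_r; lra.
  have p0 : p <> RtoC 0 by move=> e; move: hp; rewrite e /nsq /Re /Im /=; lra.
  have [v ev] := cls_surj (phi (cls (Cstar p0))).
  have := h p hp (Cstar p0) v erefl ev.
  have -> : sphere_lin c d p = 1 + nsq p.
    rewrite /sphere_lin ep; have -> : Re (d * p)%C = nsq d / (1 - c).
      by rewrite /p /nsq /Re /Im /=; field; lra.
    by rewrite (_ : nsq d = (1 - c) * (1 + c)); [field; lra|lra].
  rewrite Rpow_mult_distr => e; have := height_lt1 v.
  have : 0 < (1 + nsq p) ^ 2 by apply: pow_lt; lra.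
  by nra.
have c1 : c = 1 by move: hcd; rewrite d0 /nsq /Re /Im /=; nra.
have := h z hz z w erefl ew; rewrite d0 c1 /sphere_lin /height.
have := nsq_cstar w; have := nsq_cstar z.
move: (nsq z) (nsq w) => x y x0 y0.
rewrite Cmult_0_l /Re /= => e.
have {}e : (y - x) * (x * y - 1) = 0.
  have : (1 - 2 / (1 + y)) * (1 + x) * ((1 - 2 / (1 + y)) * (1 + x)) =
    (x - 1) * (x - 1) by lra.
  move/(congr1 (fun t => t * ((1 + y) * (1 + y)))).
  rewrite (_ : _ * ((1 + y) * (1 + y)) = (y - 1) * (y - 1) * ((1 + x) * (1 + x))).
    by lra.
  by field; lra.
case/Rmult_integral: e => e; [left; lra|right].
by apply: (Rmult_eq_reg_l x); [rewrite Rinv_r; lra|lra].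
Qed.

(** * Isometries are rotations or reflections *)

Definition conj_if (b : bool) (z : C) : C := if b then Cconj z else z.

(** For [nsq c = 1] these are the rotations and reflections of the plane that fix 0. *)
Definition twist (c : C) (b : bool) (z : C) : C := (c * conj_if b z)%C.

Lemma nsq_conj_if b z : nsq (conj_if b z) = nsq z.
Proof. by case: b => //; apply: nsq_conj. Qed.

Lemma nsq_twist c b z : nsq c = 1 -> nsq (twist c b z) = nsq z.
Proof. by move=> hc; rewrite /twist nsq_mul hc nsq_conj_if Rmult_1_l. Qed.

Lemma nsq_gt1_neq0 z : 1 < nsq z -> z <> RtoC 0.
Proof. by move=> h e; move: h; rewrite e /nsq /Re /Im /=; lra. Qed.

Lemma unit_neq0 c : nsq c = 1 -> c <> RtoC 0.
Proof. by move=> h e; move: h; rewrite e /nsq /Re /Im /=; lra. Qed.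

Lemma Cconj_neq0 z : z <> RtoC 0 -> Cconj z <> RtoC 0.
Proof.
move=> z0 h; apply: z0; apply: nsq_eq0.
by rewrite -nsq_conj h /nsq /Re /Im /=; ring.
Qed.

Lemma conj_if_neq0 b z : z <> RtoC 0 -> conj_if b z <> RtoC 0.
Proof. by case: b => //; apply: Cconj_neq0. Qed.

Lemma unit_conj c : nsq c = 1 -> (c * Cconj c = RtoC 1)%C.
Proof.
rewrite /nsq => h; apply: injective_projections; rewrite /=; last by ring.
by rewrite -h /Re /Im; ring.
Qed.

Lemma cdir_conj_if b e z : cdir (conj_if b) e z (conj_if b (axis e)).
Proof.
have h := cdiff_id z e; rewrite Cmult_1_r in h.
by case: b => //; apply: cdir_conj.
Qed.

Lemma cdir_twist c b e z : cdir (twist c b) e z (twist c b (axis e)).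
Proof.
apply: cder_eq (cdir_mul (cdir_cst c e z) (cdir_conj_if b e z)) _.
by rewrite /twist; ring.
Qed.

(** Differentiating |H|^2 = 1 along both axes gives conj(H) H' = 0, and H does not vanish. *)
Lemma unimodular_const (V : C -> Prop) H H1 z0 : open V -> V z0 ->
  (forall z, V z -> cdiff H z (H1 z)) -> (forall z, V z -> nsq (H z) = 1) ->
  locally z0 (fun z => H z = H z0).
Proof.
move=> oV V0 hH h1; apply: (cdiff_const_near (oV z0 V0)) => z Vz.
suff <- : H1 z = RtoC 0 by exact: hH.
have h0 := unit_neq0 (h1 z Vz).
have e : (Cconj (H z) * H1 z = RtoC 0)%C.
  apply: Cext_dir => b; have hd := rdir_nsq (hH z Vz b).
  have := rdir_unique (rdir_on oV Vz h1 hd) (rder_cst 1 _).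
  by rewrite /Re /Im /= => ?; lra.
by rewrite -[LHS]Cmult_1_l -(unit_conj (h1 z Vz)) -Cmult_assoc e Cmult_0_r.
Qed.

Lemma cdiff_pow n z : cdiff (fun w => Cpow w n.+1) z (RtoC (INR n.+1) * Cpow z n)%C.
Proof.
elim: n => [|n IH].
  by apply: cdiff_eq (cdiff_mul (cdiff_id z) (cdiff_cst (RtoC 1) z)) _ => /=; ring.
apply: cdiff_eq (cdiff_mul (cdiff_id z) IH) _.
rewrite [INR n.+2]S_INR RtoC_plus [Cpow z n.+1]Cpow_S; ring.
Qed.

(** Since |k| = 1, the hypothesis amounts to Re ((k - 1) z^(n+1)) = 0 near [z0]. A holomorphic
    function with vanishing real part has derivative 0, so (k - 1)(n + 1) z0^n = 0. *)
Lemma unit_rotation_eq1 k n z0 : nsq k = 1 -> z0 <> RtoC 0 ->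
  locally z0 (fun z => nsq (k * Cpow z n.+1 - RtoC 1)%C =
                       nsq (Cpow z n.+1 - RtoC 1)%C) -> k = RtoC 1.
Proof.
move=> hk z00 h.
have {}h : locally z0 (fun z => Re ((k - RtoC 1) * Cpow z n.+1)%C = 0).
  apply: filter_imp h => z; move: (Cpow z n.+1) hk => [x y]; case: (k) => a b.
  rewrite /nsq /Re /Im /= => hk.
  have : (a * a + b * b) * (x * x + y * y) = x * x + y * y by rewrite hk; ring.
  by lra.
have hF := cdiff_mul (cdiff_cst (k - RtoC 1)%C z0) (cdiff_pow n z0).
have : (RtoC 0 * Cpow z0 n.+1 + (k - RtoC 1) * (RtoC (INR n.+1) * Cpow z0 n) =
        RtoC 0)%C.
  apply: Cext_dir => b; apply: rder_unique (hF b).1 _.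
  apply: (rder_loc (f := fun=> 0)).
    have := @locally_seg _ b _ h; apply: filter_imp => s; by rewrite /= => ->.
  by apply: rder_eq (rder_cst _ _) _; rewrite /Re /Im /=; ring.
rewrite Cmult_0_l Cplus_0_l => e.
have n0 : (RtoC (INR n.+1) * Cpow z0 n <> RtoC 0)%C.
  apply: Cmult_neq_0; last exact: Cpow_nz.
  by move=> /RtoC_inj; apply: not_0_INR.
have -> : (k = (k - RtoC 1) * (RtoC (INR n.+1) * Cpow z0 n)
           / (RtoC (INR n.+1) * Cpow z0 n) + RtoC 1)%C by field; split;
  [apply: Cpow_nz | move=> /RtoC_inj; apply: not_0_INR].
by rewrite e /Cdiv Cmult_0_l Cplus_0_l.
Qed.

Lemma ex_diff_n_affine a b n x y : ex_diff_n (fun u v => a * u + b * v) n x y.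
Proof.
have cst c k u v : ex_diff_n (fun _ _ => c) k u v.
  elim: k c => [|k IH] c /=; split=> //; try exact: continuity_2d_pt_const.
  split; first exact: ex_derive_const.
  split; first exact: ex_derive_const.
  by split; apply: ex_diff_n_ext_loc (IH 0); apply: locally_2d_forall => *;
    rewrite Derive_const.
have c0 : continuity_2d_pt (fun u v => a * u + b * v) x y.
  apply: continuity_2d_pt_plus; apply: continuity_2d_pt_mult;
  by [apply: continuity_2d_pt_const | apply: continuity_2d_pt_id1
     | apply: continuity_2d_pt_id2].
have d1 u v : is_derive (fun t => a * t + b * v) u a by auto_derive => //; ring.
have d2 u v : is_derive (fun t => a * u + b * t) v b by auto_derive => //; ring.
case: n => [|n] /=; split => //.
split; first by exists a.
split; first by exists b.
split; [apply: ex_diff_n_ext_loc (cst a _ _ _)|apply: ex_diff_n_ext_loc (cst b _ _ _)];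
  apply: locally_2d_forall => u v; symmetry; apply: is_derive_unique;
  by [apply: d1 | apply: d2].
Qed.

Lemma smooth_twist c b U : smooth_on U (twist c b).
Proof.
have [s hs] : exists s : R, forall z, conj_if b z = (Re z, s * Im z).
  by case: b; [exists (-1)|exists 1] => z; apply: injective_projections;
    rewrite /= /Re /Im; ring.
move=> [x y] n _; case: c => p q; split.
  apply: ex_diff_n_ext_loc (ex_diff_n_affine p (- s * q) n x y).
  by apply: locally_2d_forall => u v; rewrite /twist hs /Re /Im /=; ring.
apply: ex_diff_n_ext_loc (ex_diff_n_affine q (s * p) n x y).
by apply: locally_2d_forall => u v; rewrite /twist hs /Re /Im /=; ring.
Qed.

Lemma nsq_rdiff_twist c b z v : nsq c = 1 -> nsq (rdiff (twist c b) z v) = nsq v.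
Proof.
move=> hc; rewrite rdiffE !(partial_unique (cdir_twist _ _ _ _)).
transitivity (nsq (twist c b v)); last exact: nsq_twist.
congr nsq; rewrite /twist; case: b; case: c {hc} => p q; case: v => x y;
  by apply: injective_projections; rewrite /= /Re /Im; ring.
Qed.

Lemma twist_neq0 c b (z : cstar) : nsq c = 1 -> twist c b z <> RtoC 0.
Proof.
move=> hc; apply: Cmult_neq_0; first exact: unit_neq0.
by apply: conj_if_neq0; apply: cval_neq0.
Qed.

Arguments twist_neq0 {c} b z _ _.

Lemma twist_antipode c b (z w : cstar) : nsq c = 1 -> cval w = twist c b z ->
  cval (antipode w) = twist c b (antipode z).
Proof.
move=> hc e; rewrite /= e /twist; have z0 := @cval_neq0 z.
have c0 := unit_neq0 hc; have h := unit_conj hc.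
have cc0 : Cconj c <> RtoC 0 by apply: Cconj_neq0.
have zz0 := Cconj_neq0 z0.
have -> : (RtoC (-1) / Cconj (c * conj_if b z) =
  (c * Cconj c) * RtoC (-1) / Cconj (c * conj_if b z))%C by rewrite h; congr Cdiv; ring.
rewrite Cmult_conj; case: b {e} => /=.
  rewrite Cconj_conj Cdiv_conj // Cconj_conj.
  have -> : Cconj (RtoC (-1)) = RtoC (-1) by apply: injective_projections => /=; ring.
  by field.
by field.
Qed.

Definition moved (phi : Hquot -> Hquot) (c : C) (b : bool) (z : C) : Prop :=
  forall z' w : cstar, cval z' = z -> cval w = twist c b z -> phi (cls z') = cls w.

Lemma local_form m phi z0 : preserves_metric m phi -> smooth_quot phi ->
  1 < nsq z0 -> exists c b, nsq c = 1 /\ locally z0 (moved phi c b).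
Proof.
move=> hm hs h0; have n0 := nsq_gt1_neq0 h0.
have [U [f [U0 hl]]] := hs (Cstar n0).
have [V [g [V0 VU hg gf _]]] := lift_local hm hl U0 h0.
have [_ _ _ hw] := hl; have [oV sg _] := hg.
have hV0 := locally_singleton _ _ V0.
have gq z : nsq (g z) = nsq (f z) by case: gf => -> //; apply: nsq_conj.
have hmod z : V z -> nsq (g z) = nsq z \/ nsq (g z) = / nsq z.
  move=> Vz; have [Uz hz] := VU z Vz.
  have [w [ew e]] := hw (Cstar (nsq_gt1_neq0 hz)) Uz.
  rewrite gq -ew; apply: (@modulus_preserved m phi (Cstar (nsq_gt1_neq0 hz))) => //.
  by rewrite /=; lra.
have cg : rcont (fun z => nsq (g z)) z0.
  by have [? ?] := smooth_rcont sg hV0; apply: rcont_nsq_comp.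
have inv_lt z : 1 < nsq z -> / nsq z < 1.
  by move=> hz; rewrite -Rinv_1; apply: Rinv_lt_contravar; lra.
pose W Q := fun z => locally z (fun x => V x /\ Q x).
have oW Q : open (W Q) by move=> z; apply: locally_locally.
have WE Q z : W Q z -> V z /\ Q z by apply: locally_singleton.
have lift z (z' : cstar) w : V z -> cval z' = z -> f z = cval w ->
    phi (cls z') = cls w.
  move=> Vz ez ew; have [Uz _] := VU z Vz; rewrite -ez in Uz ew.
  by have [w' [ew' ->]] := hw z' Uz; congr cls; apply: cval_inj; rewrite ew' ew.
case: (hmod z0 hV0) => e0.
  have W0 : W (fun z => nsq (g z) = nsq z) z0.
    have hgt : locally z0 (fun z => 0 < nsq (g z) - 1).
      apply: (@continuity_gt0 (fun z => nsq (g z) - 1)); last by lra.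
      exact: (rcont_sub cg (rcont_cst 1 z0)).
    apply: filter_imp (filter_and _ _ (oV z0 hV0) hgt) => z [Vz hz]; split => //.
    by case: (hmod z Vz) => // e; have [_ /inv_lt] := VU z Vz; lra.
  (* When |g| = |z| the quotient g / z is unimodular, hence constant; in the other case the product
     g z plays this role. *)
  pose H z := (g z * / z)%C.
  have zn z : V z -> z <> RtoC 0 by move=> /VU [_]; apply: nsq_gt1_neq0.
  have Hc : locally z0 (fun z => H z = H z0).
    apply: (unimodular_const (oW _) W0) => z /WE [Vz ez].
      exact: cdiff_mul (holo_cdiff hg Vz) (cdiff_inv (cdiff_id z) (zn z Vz)).
    rewrite /H nsq_mul (nsq_inv (zn z Vz)) ez; field.
    exact: nsq_neq0 (zn z Vz).
  have H1 : nsq (H z0) = 1.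
    by rewrite /H nsq_mul (nsq_inv n0) e0; field; apply: nsq_neq0.
  have hgz : locally z0 (fun z => V z /\ g z = (H z0 * z)%C).
    apply: filter_imp (filter_and _ _ (oV z0 hV0) Hc) => z [Vz <-]; split=> //.
    by rewrite /H; field; apply: zn.
  case: gf => gf.
    exists (H z0), false; split => //.
    by apply: filter_imp hgz => z [Vz ez] z' w ez' ew; apply: (lift z) => //;
      rewrite -gf ez ew.
  exists (Cconj (H z0)), true; split; first by rewrite nsq_conj.
  apply: filter_imp hgz => z [Vz ez] z' w ez' ew; apply: (lift z) => //.
  by rewrite ew -(Cconj_conj (f z)) -gf ez Cmult_conj.
have W0 : W (fun z => nsq (g z) = / nsq z) z0.
  have hgt : locally z0 (fun z => 0 < 1 - nsq (g z)).
    apply: (@continuity_gt0 (fun z => 1 - nsq (g z))); last by rewrite e0; have := inv_lt z0 h0; lra.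
    exact: (rcont_sub (rcont_cst 1 z0) cg).
  apply: filter_imp (filter_and _ _ (oV z0 hV0) hgt) => z [Vz hz]; split => //.
  by case: (hmod z Vz) => // e; have [_ ?] := VU z Vz; lra.
pose H z := (g z * z)%C.
have zn z : V z -> z <> RtoC 0 by move=> /VU [_]; apply: nsq_gt1_neq0.
have Hc : locally z0 (fun z => H z = H z0).
  apply: (unimodular_const (oW _) W0) => z /WE [Vz ez].
    exact: cdiff_mul (holo_cdiff hg Vz) (cdiff_id z).
  rewrite /H nsq_mul ez; field.
  exact: nsq_neq0 (zn z Vz).
have H1 : nsq (H z0) = 1.
  by rewrite /H nsq_mul e0; field; apply: nsq_neq0.
have H0 := unit_neq0 H1; have uH := unit_conj H1.
have hgz : locally z0 (fun z => V z /\ g z = (H z0 * / z)%C).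
  apply: filter_imp (filter_and _ _ (oV z0 hV0) Hc) => z [Vz <-]; split=> //.
  by rewrite /H; field; apply: zn.
move: (H z0) H1 H0 uH hgz => k H1 H0 uH hgz.
have Hi : (/ Cconj (k) = k)%C.
  by rewrite -[LHS]Cmult_1_l -uH; field; apply: Cconj_neq0.
have Hi' : (/ k = Cconj (k))%C.
  by rewrite -[LHS]Cmult_1_l -uH; field.
case: gf => gf.
  (* Here g = k / z. As 1 / conj(k) = k, its antipode is z -> - k conj(z); for the conjugate lift it
     is z -> - conj(k) z. Both induce the same map on classes as the lift itself. *)
  exists (- k)%C, true; split; first by rewrite -H1 /nsq /Re /Im /=; ring.
  apply: filter_imp hgz => z [Vz ez] z' w ez' ew; rewrite -(cls_antipode w).
  apply: (lift z) => //; rewrite /= ew /twist /= -gf ez.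
  have z1 := zn z Vz; have z2 := Cconj_neq0 z1.
  by rewrite Cmult_conj Copp_conj Cconj_conj -{1}Hi; field; split => //;
    apply: Cconj_neq0.
exists (- Cconj (k))%C, false; split.
  by rewrite -H1 -nsq_conj /nsq /Re /Im /=; ring.
apply: filter_imp hgz => z [Vz ez] z' w ez' ew; rewrite -(cls_antipode w).
apply: (lift z) => //; rewrite /= ew /twist /= -(Cconj_conj (f z)) -gf ez.
have z1 := zn z Vz; have z2 := Cconj_neq0 z1.
by rewrite !Cmult_conj Copp_conj Cconj_conj Cinv_conj // // -Hi'; field.
Qed.

Lemma nsq_pow z n : nsq (Cpow z n) = nsq z ^ n.
Proof.
elim: n => [|n IH]; first by rewrite /nsq /Re /Im /=; ring.
by rewrite Cpow_S nsq_mul IH.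
Qed.

Lemma nsq_wcoef m z : z <> RtoC 0 -> nsq (wcoef m z) =
  / nsq z ^ m.+3 * nsq (Cpow z (2 * m + 2)%N - RtoC 1)%C.
Proof.
move=> z0; rewrite /wcoef (nsq_mul (/ _)%C) nsq_inv ?nsq_pow //.
exact: Cpow_nz.
Qed.

Lemma nsq_wcoef_conj_if m b z : z <> RtoC 0 -> nsq (wcoef m (conj_if b z)) = nsq (wcoef m z).
Proof. by move=> z0; case: b => //=; rewrite wcoef_conj // nsq_conj. Qed.

Lemma twist_conj_if c b z : twist c b z = conj_if b (conj_if b c * z)%C.
Proof. by case: b => //; rewrite /twist /conj_if Cmult_conj Cconj_conj. Qed.

Lemma nsq_wcoef_twist m c b z : nsq c = 1 -> Cpow c (2 * m + 2)%N = RtoC 1 ->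
  z <> RtoC 0 -> nsq (wcoef m (twist c b z)) = nsq (wcoef m z).
Proof.
move=> hc hN z0; have c0 := unit_neq0 hc.
rewrite /twist nsq_wcoef; last by apply: Cmult_neq_0 => //; apply: conj_if_neq0.
rewrite Cpow_mult_l hN Cmult_1_l nsq_mul hc Rmult_1_l -nsq_wcoef.
  exact: nsq_wcoef_conj_if.
exact: conj_if_neq0.
Qed.

(** The invariance of the metric under the antipodal map, whose differential scales squared lengths
    by 1 / |w|^4. The sign of -1 / conj(w) disappears because the exponent 2 m + 2 is even. *)
Lemma nsq_wcoef_antipode m (w : cstar) :
  (1 + nsq (antipode w)) ^ 2 * nsq (wcoef m (antipode w)) =
  (1 + nsq w) ^ 2 * nsq (wcoef m w) * nsq w ^ 2.
Proof.
have w0 := @cval_neq0 w; have s0 := nsq_cstar w.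
rewrite !nsq_wcoef //; last exact: cval_neq0.
rewrite nsq_antipode.
have -> : nsq (Cpow (antipode w) (2 * m + 2)%N - RtoC 1)%C =
    nsq (Cpow w (2 * m + 2)%N - RtoC 1)%C * / nsq w ^ (2 * m + 2)%N.
  have cw0 := Cconj_neq0 w0.
  have cp0 : Cpow (Cconj w) (2 * m + 2)%N <> RtoC 0 by apply: Cpow_nz.
  have -> : Cpow (antipode w) (2 * m + 2)%N = (/ Cpow (Cconj w) (2 * m + 2)%N)%C.
    rewrite /= Cpow_mult_l Cpow_inv // (_ : Cpow (RtoC (-1)) _ = RtoC 1); first by ring.
    rewrite (_ : (2 * m + 2)%N = (2 * m.+1)%N); last by rewrite mulnS addnC.
    rewrite Cpow_mult_r (_ : Cpow (RtoC (-1)) 2 = RtoC 1) ?Cpow_1_l //.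
    by apply: injective_projections => /=; ring.
  have -> : (/ Cpow (Cconj w) (2 * m + 2)%N - RtoC 1 =
      - Cconj (Cpow w (2 * m + 2)%N - RtoC 1) * / Cpow (Cconj w) (2 * m + 2)%N)%C.
    rewrite Cminus_conj Cpow_conj (_ : Cconj (RtoC 1) = RtoC 1); first by field.
    by apply: injective_projections => /=; ring.
  rewrite nsq_mul nsq_inv // nsq_pow nsq_conj; congr (_ * _).
  by rewrite /nsq /Re /Im /=; ring.
have pm : nsq w ^ m <> 0 by apply: pow_nonzero; lra.
have -> : nsq w ^ (2 * m + 2)%N = nsq w ^ m * nsq w ^ m * nsq w ^ 2.
  by rewrite mul2n -addnn !pow_add.
rewrite (_ : m.+3 = (m + 3)%N) ?pow_add ?pow_inv; last by rewrite addn3.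
by field; repeat split => //; lra.
Qed.

Lemma open_neq0 : open (fun z : C => z <> RtoC 0).
Proof.
move=> z /nsq_gt0 h.
apply: filter_imp (continuity_gt0 (rcont_nsq z) h) => w hw e; move: hw.
by rewrite e /nsq /Re /Im /=; lra.
Qed.

Lemma moved_lift phi c b V : nsq c = 1 -> open V ->
  (forall z, V z -> z <> RtoC 0 /\ moved phi c b z) -> local_lift phi V (twist c b).
Proof.
move=> hc oV hV; split => //; first by move=> z /hV [].
  exact: smooth_twist.
move=> z /hV [_ hz]; exists (Cstar (twist_neq0 b z hc)); split => //.
exact: hz.
Qed.

Lemma moved_root m phi c b z0 : preserves_metric m phi -> nsq c = 1 ->
  1 < nsq z0 -> locally z0 (moved phi c b) -> Cpow c (2 * m + 2)%N = RtoC 1.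
Proof.
move=> hm hc h0 h; pose V z := locally z (fun t => 1 < nsq t /\ moved phi c b t).
have VE z : V z -> 1 < nsq z /\ moved phi c b z by apply: locally_singleton.
have oV : open V by move=> z; apply: locally_locally.
have V0 : V z0 by apply: filter_and h; apply: nsq_gt1_near.
have hl : local_lift phi V (twist c b).
  by apply: moved_lift => // z /VE [/nsq_gt1_neq0].
(* [twist c b z] is [k * z], conjugated if [b] holds. Conjugation does not change the modulus of
   [wcoef], so only the rotation by [k] matters. *)
pose k := conj_if b c.
have hk : nsq k = 1 by rewrite /k nsq_conj_if.
suff e : Cpow k (2 * m + 2)%N = RtoC 1.
  move: e; rewrite /k; case: (b) => //= e.
  rewrite -(Cconj_conj c) -Cpow_conj e.
  by apply: injective_projections => /=; ring.
move: (nsq_gt1_neq0 h0) => z00.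
rewrite addn2; apply: (@unit_rotation_eq1 _ (2 * m).+1 z0) => //.
  by rewrite nsq_pow hk pow1.
apply: filter_imp (oV z0 V0) => z Vz.
have [hz _] := VE z Vz; have zn0 := nsq_gt1_neq0 hz.
have kz0 : (k * z)%C <> RtoC 0 by apply: Cmult_neq_0 => //; apply: unit_neq0.
have := hm _ _ hl z (RtoC 1) Vz; rewrite !ds2E nsq_rdiff_twist // nsq_twist //.
rewrite twist_conj_if -/k nsq_wcoef_conj_if // !nsq_wcoef // nsq_mul hk Rmult_1_l Cpow_mult_l.
rewrite addn2 (_ : nsq (RtoC 1) = 1); last by rewrite /nsq /Re /Im /=; ring.
have s0 : nsq z ^ m.+3 <> 0 by apply: pow_nonzero; lra.
move: (nsq (_ - _)%C) (nsq (Cpow z _ - _)%C) => A B e.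
have p0 : / 4 * (1 + nsq z) ^ 2 * / nsq z ^ m.+3 <> 0.
  apply: Rmult_integral_contrapositive; split; last exact: Rinv_neq_0_compat.
  by have : 0 < (1 + nsq z) ^ 2 by [apply: pow_lt; lra]; lra.
by apply: (Rmult_eq_reg_l _ _ _ _ p0); lra.
Qed.

Lemma twist_inj_near c b c' b' z0 : c <> RtoC 0 ->
  locally z0 (fun z => twist c b z = twist c' b' z) -> (c, b) = (c', b').
Proof.
move=> c0 h; have e d := cdir_unique (cdir_loc h (cdir_twist c b d z0)) (cdir_twist c' b' d z0).
have e1 : c = c'.
  have := e false; rewrite /twist /conj_if /=.
  have -> : Cconj (RtoC 1) = RtoC 1 by apply: injective_projections => /=; ring.
  by case: (b) (b') => [] []; rewrite !Cmult_1_r.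
subst c'; have := e true; rewrite /twist.
case: (b) (b') => [] [] //= E; case: c0; move: (congr1 Re E) (congr1 Im E);
  by case: (c) => x y; rewrite /Re /Im /= => ? ?; apply: injective_projections;
    rewrite /=; lra.
Qed.

(** Equal classes could come from antipodal points, but both representatives have modulus |z| > 1,
    and the antipode of such a point has modulus below 1. *)
Lemma moved_unique phi c b c' b' z0 : nsq c = 1 -> nsq c' = 1 -> 1 < nsq z0 ->
  locally z0 (moved phi c b) -> locally z0 (moved phi c' b') -> (c, b) = (c', b').
Proof.
move=> hc hc' h0 h h'; apply: (@twist_inj_near _ _ _ _ z0); first exact: unit_neq0.
apply: filter_imp (filter_and _ _ (nsq_gt1_near h0) (filter_and _ _ h h')).
move=> z [hz [m1 m2]]; pose z1 := Cstar (nsq_gt1_neq0 hz).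
pose w := Cstar (twist_neq0 b z1 hc); pose w' := Cstar (twist_neq0 b' z1 hc').
have /cls_eq [e|e] : cls w' = cls w by rewrite -(m1 z1 w) // -(m2 z1 w').
  by have := congr1 cval e.
have := nsq_antipode w'; rewrite -e /= !nsq_twist // => e'.
by have : / nsq z < 1 by [rewrite -Rinv_1; apply: Rinv_lt_contravar; lra]; lra.
Qed.

(* A lift of [phi] is either [twist c b] or its antipode; each alternative is the
   vanishing of one continuous function. *)
Definition lift_gap (f : C -> C) c b x : R := nsq (f x - twist c b x)%C.

(** The equation f x = -1 / conj([twist c b x]), cleared of its denominator. *)
Definition antilift_gap (f : C -> C) c b x : R :=
  nsq (f x * Cconj (twist c b x) + RtoC 1)%C.

Lemma rcont_gap phi U f c b z : local_lift phi U f -> U z ->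
  rcont (lift_gap f c b) z /\ rcont (antilift_gap f c b) z.
Proof.
move=> [_ _ hf _] Uz; have [f1 f2] := smooth_rcont hf Uz.
have [g1 g2] := smooth_rcont (@smooth_twist c b U) Uz.
split; apply: rcont_nsq_comp.
- exact: (rcont_sub f1 g1).
- exact: (rcont_sub f2 g2).
- exact: (rcont_add (rcont_sub (rcont_mul f1 g1) (rcont_mul f2 (rcont_opp g2)))
    (rcont_cst 1 _)).
- exact: (rcont_add (rcont_add (rcont_mul f1 (rcont_opp g2)) (rcont_mul f2 g1))
    (rcont_cst 0 _)).
Qed.

Lemma moved_gap phi U f c b z : nsq c = 1 -> local_lift phi U f -> U z ->
  moved phi c b z -> z <> RtoC 0 ->
  lift_gap f c b z = 0 \/ antilift_gap f c b z = 0.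
Proof.
move=> hc [_ _ _ hw] Uz h z0; pose y := Cstar (twist_neq0 b (Cstar z0) hc).
have [v [ev e]] := hw (Cstar z0) Uz; rewrite /lift_gap /antilift_gap -ev.
have /cls_eq [->|->] : cls y = cls v by rewrite -e (h (Cstar z0) y).
  by left; rewrite /= /Cminus Cplus_opp_r /nsq /Re /Im /=; ring.
right; have y0 := Cconj_neq0 (@cval_neq0 y).
rewrite -/(cval y) /= (_ : (_ + _ = RtoC 0)%C); last by field.
by rewrite /nsq /Re /Im /=; ring.
Qed.

Lemma global_form m phi : preserves_metric m phi -> smooth_quot phi ->
  exists c b, [/\ nsq c = 1, Cpow c (2 * m + 2)%N = RtoC 1 &
    forall z, moved phi c b z].
Proof.
move=> hm hs; pose zb : C := (2, 0).
have hb : 1 < nsq zb by rewrite /nsq /Re /Im /=; lra.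
have [c [b [hc h]]] := local_form hm hs hb; exists c, b.
have cN := moved_root hm hc hb h; split => //.
have {h}hout z : 1 < nsq z -> moved phi c b z.
  move=> hz; apply: locally_singleton.
  apply: (@connected_outside (fun z => locally z (moved phi c b))) (hb) (hz) (h)
    => {z hz} z hz.
  have [c' [b' [hc' h']]] := local_form hm hs hz.
  case: (excluded_middle_informative ((c, b) = (c', b'))) => [[-> ->]|ne].
    by left; apply: locally_locally.
  right; apply: filter_imp (filter_and _ _ (nsq_gt1_near hz) (locally_locally _ _ h')).
  by move=> x [hx h1] h2; apply: ne; apply: moved_unique h2 h1.
have hin z : 1 <= nsq z -> moved phi c b z.
  move=> hz z' w ez ew; have [U [f [U0 hl]]] := hs z'; have [oU _ _ _] := hl.
  (* Outside the disc the alternative may depend on the point, so neither gap alone passes to the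
     limit; their product does, and both alternatives give the same class. *)
  have D0 : lift_gap f c b z' * antilift_gap f c b z' = 0.
    have [? ?] := rcont_gap c b hl U0.
    apply: (@closure_outside (fun x => lift_gap f c b x * antilift_gap f c b x)).
    - by rewrite ez.
    - exact: rcont_mul.
    apply: filter_imp (oU _ U0) => x Ux hx.
    have := moved_gap hc hl Ux (hout x hx) (nsq_gt1_neq0 hx).
    by case=> ->; ring.
  have [_ _ _ hw] := hl; have [v [ev ->]] := hw z' U0.
  apply/cls_eq; case: (Rmult_integral _ _ D0) => /nsq_eq0; rewrite -ev ez -ew => e.
    left; apply: cval_inj; have := congr1 (Cplus^~ (cval w)) e; rewrite /= Cplus_0_l => <-.
    by ring.
  have w0 := Cconj_neq0 (@cval_neq0 w).
  suff -> : v = antipode w by right; rewrite antipodeK.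
  apply: cval_inj; rewrite /=.
  have -> : (cval v = (v * Cconj w + RtoC 1 - RtoC 1) / Cconj w)%C by field.
  by rewrite e; field.
move=> z z' w ez ew; case: (Rle_lt_dec 1 (nsq z)) => hz; first exact: hin ez ew.
have ha := twist_antipode hc (etrans ew (congr1 (twist c b) (esym ez))).
rewrite -(cls_antipode z') -(cls_antipode w); apply: (hin (antipode z')) => //.
rewrite nsq_antipode ez; have h0 := nsq_cstar z'; rewrite ez in h0.
by rewrite -Rinv_1; apply/Rlt_le; apply: Rinv_lt_contravar; lra.
Qed.

Definition repr (S : Hquot) : cstar :=
  proj1_sig (constructive_indefinite_description _ (cls_surj S)).

Lemma reprK S : cls (repr S) = S.
Proof. by rewrite /repr; case: constructive_indefinite_description. Qed.

(* The map of the quotient induced by [T]; only meaningful when [T] commutes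
   with [antipode]. *)
Definition qmap (T : cstar -> cstar) (S : Hquot) : Hquot := cls (T (repr S)).

Lemma qmap_cls T z : commutes_antipode T -> qmap T (cls z) = cls (T z).
Proof.
move=> hT; rewrite /qmap; have /cls_eq [->|->] // := esym (reprK (cls z)).
by rewrite hT cls_antipode.
Qed.

Lemma induces_qmap T : commutes_antipode T -> induces T (qmap T).
Proof. by move=> hT; split=> // z; apply: qmap_cls. Qed.

Lemma induces_eq T phi psi : induces T phi -> induces T psi -> phi = psi.
Proof.
move=> [_ h1] [_ h2]; apply: functional_extensionality => S.
by have [z ->] := cls_surj S; rewrite h1 h2.
Qed.

Lemma induces_comp T T' phi psi : induces T phi -> induces T' psi ->
  induces (T \o T') (phi \o psi).
Proof.
move=> [c1 h1] [c2 h2]; split=> z /=; first by rewrite c2 c1.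
by rewrite h2 h1.
Qed.

(** * Rotations and reflections are isometries *)

(** The antipode of [twist c b z] when |c| = 1, by 1 / conj(c) = c, as a function on [C] that can be
    differentiated. *)
Definition anti (c : C) (b : bool) (z : C) : C := (- c * / conj_if (~~ b) z)%C.

Lemma cdir_anti c b e z : z <> RtoC 0 -> cdir (anti c b) e z
  (c * conj_if (~~ b) (axis e) / (conj_if (~~ b) z * conj_if (~~ b) z))%C.
Proof.
move=> z0; have n0 := conj_if_neq0 (b := ~~ b) z0.
have hi := cdir_inv (cdir_conj_if (~~ b) e z) n0.
by apply: cder_eq (cdir_mul (cdir_cst (- c)%C e z) hi) _; field.
Qed.

Lemma antipode_twist c b (z w : cstar) : nsq c = 1 -> cval w = twist c b z ->
  cval (antipode w) = anti c b z.
Proof.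
move=> hc ew; rewrite (twist_antipode hc ew) /twist /anti.
have z0 := @cval_neq0 z; have zz0 := Cconj_neq0 z0.
case: b {ew} => /=; last by field.
rewrite Cdiv_conj // Cconj_conj.
have -> : Cconj (RtoC (-1)) = RtoC (-1) by apply: injective_projections => /=; ring.
by field.
Qed.

Lemma nsq_rdiff_anti c b z v : nsq c = 1 -> z <> RtoC 0 ->
  nsq (rdiff (anti c b) z v) * nsq z ^ 2 = nsq v.
Proof.
move=> hc z0; have n0 := conj_if_neq0 (b := ~~ b) z0.
rewrite rdiffE !(partial_unique (cdir_anti _ _ _ z0)).
have -> : (c * conj_if (~~ b) (axis false) / (conj_if (~~ b) z * conj_if (~~ b) z) * Re v +
    c * conj_if (~~ b) (axis true) / (conj_if (~~ b) z * conj_if (~~ b) z) * Im v =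
    twist c (~~ b) v * / (conj_if (~~ b) z * conj_if (~~ b) z))%C.
  rewrite /twist; have -> : conj_if (~~ b) v = (conj_if (~~ b) (axis false) * RtoC (Re v) +
      conj_if (~~ b) (axis true) * RtoC (Im v))%C.
    by case: b {n0} => /=; apply: injective_projections; rewrite /= /Re /Im; ring.
  by field.
rewrite nsq_mul nsq_twist // nsq_inv; last exact: Cmult_neq_0.
rewrite nsq_mul nsq_conj_if; field.
exact: nsq_neq0.
Qed.

Lemma rdiff_loc f g z v : locally z (fun w => f w = g w) ->
  (forall e, exists d, cdir g e z d) -> rdiff f z v = rdiff g z v.
Proof.
move=> h hg; have e b : partial b f z = partial b g z.
  have [d hd] := hg b; rewrite (partial_unique hd); apply: partial_unique.
  apply: cdir_loc hd; by apply: filter_imp h.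
by rewrite !rdiffE !e.
Qed.

(** [preserves_metric] speaks of every smooth lift, so an arbitrary one must be identified near z
    with [twist] or [anti]. A gap that is nonzero at z stays nonzero nearby, which forces the other
    one to vanish there. *)
Lemma moved_metric m phi c b : nsq c = 1 -> Cpow c (2 * m + 2)%N = RtoC 1 ->
  (forall z, moved phi c b z) -> preserves_metric m phi.
Proof.
move=> hc hN h U f hl z v Uz; have [oU z0 _ _] := hl.
have [r1 r2] := rcont_gap c b hl Uz.
have gap x : U x -> lift_gap f c b x = 0 \/ antilift_gap f c b x = 0.
  by move=> Ux; apply: moved_gap hl Ux (h x) (z0 x Ux).
have gap1 x : lift_gap f c b x = 0 -> f x = twist c b x.
  move=> /nsq_eq0 e; have := congr1 (Cplus^~ (twist c b x)) e.
  by rewrite /= Cplus_0_l => <-; ring.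
have gap2 x : U x -> antilift_gap f c b x = 0 -> f x = anti c b x.
  move=> Ux /nsq_eq0 e; pose y := Cstar (twist_neq0 b (Cstar (z0 x Ux)) hc).
  rewrite -(@antipode_twist c b (Cstar (z0 x Ux)) y) //=.
  have y0 : Cconj (twist c b x) <> RtoC 0 := Cconj_neq0 (@cval_neq0 y).
  have -> : f x = ((f x * Cconj (twist c b x) + RtoC 1 - RtoC 1) / Cconj (twist c b x))%C.
    by field.
  by rewrite e; field.
have zn := z0 z Uz.
case: (Req_dec (lift_gap f c b z) 0) => e1.
  (* The two alternatives exclude each other: at f z = [twist c b z] the expression inside the gap
     is |f z|^2 + 1. *)
  have e2 : antilift_gap f c b z <> 0.
    rewrite /antilift_gap (gap1 z e1) => /nsq_eq0 /(congr1 Re).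
    have : 0 < nsq (twist c b z) by rewrite nsq_twist //; apply: nsq_gt0.
    by rewrite /nsq /Re /Im /=; lra.
  have hloc : locally z (fun x => f x = twist c b x).
    apply: filter_imp (filter_and _ _ (oU z Uz) (rcont_neq0 r2 e2)) => x [Ux hx].
    by apply: gap1; case: (gap x Ux).
  rewrite (rdiff_loc v hloc); last by move=> e; exists (twist c b (axis e)); apply: cdir_twist.
  by rewrite (gap1 z e1) !ds2E nsq_rdiff_twist // nsq_twist // nsq_wcoef_twist.
have hloc : locally z (fun x => f x = anti c b x).
  apply: filter_imp (filter_and _ _ (oU z Uz) (rcont_neq0 r1 e1)) => x [Ux hx].
  by apply: gap2 => //; case: (gap x Ux).
rewrite (rdiff_loc v hloc); last by move=> e; eexists; apply: cdir_anti.
have hr := nsq_rdiff_anti b v hc zn.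
rewrite (locally_singleton _ _ hloc) !ds2E.
pose y := Cstar (twist_neq0 b (Cstar zn) hc).
have ha := nsq_wcoef_antipode m y; move: ha.
rewrite (@antipode_twist c b (Cstar zn) y) //= nsq_twist // nsq_wcoef_twist // => ha.
rewrite Rmult_assoc Rmult_assoc -(Rmult_assoc (_ ^ 2)) ha -hr; ring.
Qed.

Definition twist_map c b (hc : nsq c = 1) (z : cstar) : cstar := Cstar (twist_neq0 b z hc).

Lemma twist_map_commutes c b (hc : nsq c = 1) : commutes_antipode (twist_map b hc).
Proof. by move=> z; apply: cval_inj; rewrite (@twist_antipode c b z (twist_map b hc z)). Qed.

Lemma moved_twist_map phi c b (hc : nsq c = 1) :
  (forall z, moved phi c b z) <-> induces (twist_map b hc) phi.
Proof.
split=> [h|[_ h] z z' w ez ew]; last first.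
  by rewrite h; congr cls; apply: cval_inj; rewrite ew -ez.
by split=> [|z]; [apply: twist_map_commutes | apply: (h z)].
Qed.

Lemma moved_smooth phi c b : nsq c = 1 -> (forall z, moved phi c b z) ->
  smooth_quot phi.
Proof.
move=> hc h z; exists (fun z => z <> RtoC 0), (twist c b).
split; first exact: cval_neq0.
by apply: moved_lift => //; apply: open_neq0.
Qed.

Lemma twist_inv c b z : nsq c = 1 ->
  twist (if b then c else Cconj c) b (twist c b z) = z /\
  twist c b (twist (if b then c else Cconj c) b z) = z.
Proof.
move=> hc; have h := unit_conj hc; case: b; rewrite /twist /= ?Cmult_conj ?Cconj_conj.
  by rewrite Cmult_assoc h Cmult_1_l.
by split; rewrite Cmult_assoc ?(Cmult_comm (Cconj c)) h Cmult_1_l.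
Qed.

Lemma moved_Iso m phi c b : nsq c = 1 -> Cpow c (2 * m + 2)%N = RtoC 1 ->
  (forall z, moved phi c b z) -> Iso m phi.
Proof.
move=> hc hN h; split; last exact: moved_metric hc hN h.
split; first exact: moved_smooth h.
pose c' := if b then c else Cconj c.
have hc' : nsq c' = 1 by rewrite /c'; case: (b); rewrite ?nsq_conj.
pose psi := qmap (twist_map b hc').
have hpsi : induces (twist_map b hc') psi := induces_qmap (@twist_map_commutes c' b hc').
have /(moved_twist_map _ b hc) [_ h1] := h; have [_ h2] := hpsi.
have inv z := twist_inv b z hc.
exists psi; split.
- by apply: (moved_smooth hc'); apply/(moved_twist_map _ b hc').
- move=> S; have [z ->] := cls_surj S; rewrite h1 h2; congr cls.
  by apply: cval_inj; have [] := inv z.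
- move=> S; have [z ->] := cls_surj S; rewrite h2 h1; congr cls.
  by apply: cval_inj; have [] := inv z.
Qed.

(** * Group structure *)

(* Product of the normal forms [x ^+ i * y ^+ b] of a dihedral group, where
   [y] inverts [x] and [x ^- 1 = x ^+ q.-1]. *)
Definition dih_mul (q : nat) (u v : nat * bool) : nat * bool :=
  ((u.1 + (if u.2 then q.-1 * v.1 else v.1)) %% q, u.2 (+) v.2)%N.

(** The presentation supplies generators and relations, from which the words x^i y^b exhaust the
    group. Their distinctness follows by counting: there are 2 q of them and the group has order 2
    q. The separate [M] lets the result apply to 'D_(2 * q) as written in the theorem. *)
Lemma dihedral_normal_form M q : (1 < q)%N -> M = q.*2 ->
  exists nf : 'D_M -> nat * bool, [/\ injective nf,
    forall x, ((nf x).1 < q)%N, nf 1%g = (0%N, false),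
    forall x y, nf (x * y)%g = dih_mul q (nf x) (nf y)
  & forall i b, (i < q)%N -> exists x, nf x = (i, b)].
Proof.
move=> q1 ->; have q0 : (0 < q)%N by apply: ltnW.
have := homg_refl [set: (@dihedral_gtype q.*2)]%G.
rewrite (Grp_dihedral q1) => /existsP [[x y] /= /eqP [defG xq yy xy]].
have yV : (y^-1 = y)%g by apply/eqP; rewrite eq_invg_mul -expg2 yy.
have xV i : (x ^- i = x ^+ (q.-1 * i))%g.
  apply/eqP; rewrite eq_invg_mul -expgD.
  have -> : (i + q.-1 * i = q * i)%N by rewrite -mulSn prednK.
  by rewrite expgM xq expg1n.
have yx i : (y * x ^+ i = x ^+ (q.-1 * i) * y)%g.
  by rewrite conjgCV yV conjXg xy expgVn xV.
pose F (u : 'I_q * bool) : 'D_(q.*2) := (x ^+ u.1 * y ^+ u.2)%g.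
have Fmul i b (j : 'I_q) c : (F (i, b) * F (j, c))%g =
    F (Ordinal (ltn_pmod (i + (if b then q.-1 * j else j))%N q0), b (+) c).
  rewrite /F /= expg_mod // expgD -!mulgA; congr (_ * _)%g.
  case: b; last by rewrite mul1g.
  rewrite expg1 mulgA yx -!mulgA; congr (_ * _)%g.
  by case: c; rewrite /= ?mulg1 // -expg2 yy.
have surj g : exists u, F u = g.
  have : g \in (<[x]> * <[y]>)%g.
    rewrite -norm_joinEr ?defG ?inE // cycle_subG.
    by rewrite inE -cycleJ xy cycleV.
  case/mulsgP => a b /cycleP [i ->] /cycleP [j ->] ->.
  exists (Ordinal (ltn_pmod i q0), odd j); rewrite /F /= expg_mod //.
  by rewrite -[in RHS](odd_double_half j) expgD -[j./2.*2]mul2n expgM yy expg1n mulg1.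
have [G GK] := fin_all_exists surj.
have cardG : (#|{: 'I_q * bool}| <= #|'D_(q.*2)|)%N.
  rewrite card_prod card_ord card_bool muln2.
  by rewrite -[leqLHS](card_dihedral q1) cardsT leqnn.
have Gbij := inj_card_bij (can_inj GK) cardG.
have FK : cancel F G by apply/(bij_can_sym Gbij).
exists (fun g => (val (G g).1, (G g).2)); split=> /=.
- move=> g h [e1 e2]; apply: (can_inj GK).
  by case: (G g) (G h) e1 e2 => [? ?] [? ?] /= /val_inj -> ->.
- by move=> g; apply: ltn_ord.
- have <- : F (Ordinal q0, false) = 1%g by rewrite /F /= mulg1.
  by rewrite FK.
- move=> g h; rewrite -[in LHS](GK g) -[in LHS](GK h).
  by case: (G g) (G h) => [i b] [j c]; rewrite Fmul FK.
move=> i b hi; exists (F (Ordinal hi, b)); by rewrite FK.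
Qed.

Lemma INR_addn k l : INR (k + l)%N = INR k + INR l.
Proof. exact: plus_INR. Qed.

Lemma INR_muln k l : INR (k * l)%N = INR k * INR l.
Proof. exact: mult_INR. Qed.

Lemma expi_add a b : expi (a + b) = (expi a * expi b)%C.
Proof.
apply: injective_projections; rewrite /expi /= ?cos_plus ?sin_plus; ring.
Qed.

Lemma nsq_expi t : nsq (expi t) = 1.
Proof. by have := sin2_cos2 t; rewrite /nsq /expi /Re /Im /Rsqr /=; lra. Qed.

Lemma expi_pow t n : Cpow (expi t) n = expi (INR n * t).
Proof.
elim: n => [|n IH].
  by rewrite /= Rmult_0_l /expi cos_0 sin_0.
by rewrite Cpow_S IH -expi_add S_INR; congr expi; ring.
Qed.

Lemma cos_eq1 x : cos x = 1 -> exists k : Z, x = 2 * IZR k * PI.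
Proof.
move=> h; have : sin (x / 2) = 0.
  have := cos_2a_sin (x / 2); rewrite (_ : 2 * (x / 2) = x); last by field.
  by rewrite h; nra.
by move=> /sin_eq_0_0 [k hk]; exists k; lra.
Qed.

(** * The roots of unity of order 2 m + 2 and the transformations they define *)

Section Zeta.

Variable m : nat.
Local Notation N := (2 * m + 2)%N.

Let n0 : INR m.+1 <> 0.
Proof. exact: not_0_INR. Qed.

Let NE : INR N = 2 * INR m.+1.
Proof. by rewrite INR_addn INR_muln [INR m.+1]S_INR [INR 2]/=; ring. Qed.

Definition zeta (k : nat) : C := expi (INR k * (PI / INR m.+1)).

Lemma nsq_zt k : nsq (zeta k) = 1.
Proof. exact: nsq_expi. Qed.

Lemma zeta_add k l : zeta (k + l) = (zeta k * zeta l)%C.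
Proof. by rewrite /zeta INR_addn Rmult_plus_distr_r expi_add. Qed.

Lemma zeta_pow k j : Cpow (zeta k) j = zeta (j * k).
Proof. by rewrite /zeta expi_pow INR_muln; congr expi; ring. Qed.

Lemma zeta0 : zeta 0 = RtoC 1.
Proof. by rewrite /zeta Rmult_0_l /expi cos_0 sin_0. Qed.

Lemma zeta_half : zeta m.+1 = RtoC (-1).
Proof.
rewrite /zeta (_ : _ * _ = PI); last by field.
by rewrite /expi cos_PI sin_PI.
Qed.

Lemma zeta_period : zeta N = RtoC 1.
Proof.
rewrite /zeta NE (_ : _ * _ = 2 * PI); last by field.
by rewrite /expi cos_2PI sin_2PI.
Qed.

Lemma zeta_mulN k : zeta (k * N) = RtoC 1.
Proof. by rewrite -zeta_pow zeta_period Cpow_1_l. Qed.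

Lemma zeta_root k : Cpow (zeta k) N = RtoC 1.
Proof. by rewrite zeta_pow mulnC zeta_mulN. Qed.

Lemma zeta_mod k : zeta (k %% N) = zeta k.
Proof. by rewrite {2}(divn_eq k N) zeta_add zeta_mulN Cmult_1_l. Qed.

Lemma zeta_conj_eq k l : zeta (k + l) = RtoC 1 -> zeta k = Cconj (zeta l).
Proof.
rewrite zeta_add => h; have hl := unit_conj (nsq_zt l).
by rewrite -[LHS]Cmult_1_r -hl Cmult_assoc h Cmult_1_l.
Qed.

(** [N.-1 * k] stands for -k: exponents remain natural numbers, and composition takes the shape of
    [dih_mul]. *)
Lemma zeta_conj k : Cconj (zeta k) = zeta (N.-1 * k).
Proof.
symmetry; apply: zeta_conj_eq; rewrite (_ : (_ + _)%N = (k * N)%N) ?zeta_mulN //.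
by lia.
Qed.

Lemma zeta_inj k l : (k < N)%N -> (l < N)%N -> zeta k = zeta l -> k = l.
Proof.
wlog kl : k l / (k <= l)%N.
  move=> h hk hl e; case: (leqP k l) => [|/ltnW] hh; first exact: h.
  by symmetry; apply: h.
move=> hk hl e; have [d ed] : exists d, l = (k + d)%N by exists (l - k)%N; lia.
have hd : zeta d = RtoC 1.
  have := unit_conj (nsq_zt k); rewrite {1}e ed zeta_add => h.
  have := unit_conj (nsq_zt k); rewrite Cmult_comm => h'.
  by rewrite -h Cmult_comm Cmult_assoc h' Cmult_1_l.
have [j hj] := cos_eq1 (congr1 Re hd).
have n1 : 0 < INR m.+1 by apply: lt_0_INR; lia.
have ej : INR d = 2 * IZR j * INR m.+1.
  apply: (Rmult_eq_reg_r (PI / INR m.+1)); first by rewrite hj; field.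
  by have := PI_RGT_0; have := Rinv_0_lt_compat _ n1; rewrite /Rdiv; nra.
have d0 := pos_INR d.
have dN : INR d < 2 * INR m.+1 by rewrite -NE; apply: lt_INR; lia.
have j0 : (0 <= j)%Z by apply: le_IZR; nra.
have j1 : (j < 1)%Z by apply: lt_IZR; nra.
have {}j0 : j = 0%Z by lia.
move: ej; rewrite j0 => ej; have : INR d = INR 0 by rewrite ej /=; ring.
by move=> /INR_eq; lia.
Qed.

Lemma zeta_surj c : nsq c = 1 -> Cpow c N = RtoC 1 -> exists k, c = zeta k.
Proof.
move=> hc; pose z := Cstar (unit_neq0 hc); pose t := arg z.
have ec : c = expi t.
  have := congr1 cval (modulus_argE z); rewrite /polar /= -/t => <-.
  have -> : Cmod c = 1.
    by have := hc; rewrite nsq_Cmod; have := Cmod_ge_0 c; nra.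
  by rewrite Cmult_1_l.
rewrite ec expi_pow => /(congr1 Re) /cos_eq1 [j hj].
have et : t = IZR j * (PI / INR m.+1).
  apply: (Rmult_eq_reg_l (2 * INR m.+1)); last by lra.
  by rewrite -NE hj NE; field.
(* [j] may be negative; adding N |j| makes the exponent nonnegative without changing the root. *)
exists (Z.to_nat (j + Z.of_nat (N * Z.to_nat (Z.abs j)))%Z).
rewrite /zeta INR_IZR_INZ Z2Nat.id; last by nia.
rewrite plus_IZR -INR_IZR_INZ Rmult_plus_distr_r expi_add -et.
by rewrite -/(zeta _) mulnC zeta_mulN Cmult_1_r.
Qed.

Definition zmap (k : nat) (b : bool) : cstar -> cstar := twist_map b (nsq_zt k).

Lemma zmap_ext k b l c : zeta k = zeta l -> b = c -> zmap k b = zmap l c.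
Proof.
move=> h ->; apply: functional_extensionality => z; apply: cval_inj.
by rewrite /= /twist h.
Qed.

Lemma zmap_comp k b l c :
  zmap k b \o zmap l c = zmap (k + (if b then N.-1 * l else l))%N (b (+) c).
Proof.
apply: functional_extensionality => z; apply: cval_inj.
rewrite /= /twist zeta_add; case: b => /=; last by rewrite Cmult_assoc.
rewrite Cmult_conj zeta_conj Cmult_assoc; congr (_ * _)%C.
by case: c => //=; rewrite Cconj_conj.
Qed.

Lemma zmap_id : zmap 0 false = id.
Proof.
apply: functional_extensionality => z; apply: cval_inj.
by rewrite /= /twist zeta0 Cmult_1_l.
Qed.

Lemma flipE : flip = zmap m.+1 true.
Proof.
apply: functional_extensionality => z; apply: cval_inj.
rewrite /= /twist zeta_half -(congr1 cval (modulus_argE z)) /= /expi.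
rewrite Rtrigo_facts.cos_pi_minus Rtrigo_facts.sin_pi_minus.
rewrite (_ : Cmod (RtoC (Cmod z) * _) = Cmod z).
  by apply: injective_projections => /=; ring.
exact: modulus_polar (modulus z) (arg z).
Qed.

Lemma cval_turn a z : cval (turn a z) = (expi a * z)%C.
Proof.
by rewrite -[in RHS](congr1 cval (modulus_argE z)) /= expi_add; ring.
Qed.

Lemma turnE a k : expi a = zeta k -> turn a = zmap k false.
Proof.
move=> h; apply: functional_extensionality => z; apply: cval_inj.
by rewrite cval_turn h.
Qed.

Lemma turn_odd : turn (PI + PI / INR m.+1) = zmap m.+2 false.
Proof.
by apply: turnE; rewrite /zeta [INR m.+2]S_INR; congr expi; field.
Qed.

Lemma turn_two : turn (2 * PI / INR m.+1) = zmap 2 false.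
Proof. by apply: turnE; rewrite /zeta /=; congr expi; field. Qed.

Lemma turn_PI : turn PI = zmap m.+1 false.
Proof. by apply: turnE; rewrite /zeta; congr expi; field. Qed.

Lemma zmap_inv k b : exists l, zmap l b \o zmap k b = id /\ zmap k b \o zmap l b = id.
Proof.
have E l : zeta l = RtoC 1 -> zmap l (b (+) b) = id.
  by move=> h; rewrite -zmap_id; apply: zmap_ext; rewrite ?zeta0 ?addbb.
case: b E => E.
  exists k; rewrite !zmap_comp; split; apply: E; rewrite zeta_add -zeta_conj;
  exact: unit_conj (nsq_zt k).
exists (N.-1 * k)%N; rewrite !zmap_comp; split; apply: E; rewrite zeta_add -zeta_conj;
  by rewrite ?(Cmult_comm (Cconj _)); apply: unit_conj (nsq_zt k).
Qed.

Lemma Gamma_zmap T : Gamma m T -> exists k b, T = zmap k b.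
Proof.
have H (S : (cstar -> cstar) -> Prop) : (forall f, S f -> exists k b, f = zmap k b) ->
    Defs.generated S T -> exists k b, T = zmap k b.
  move=> hS; elim=> {T} [f /hS //||f g _ [k [b ->]] _ [l [c ->]]|f g _ [k [b ->]] fg gf].
  - by exists 0%N, false; rewrite zmap_id.
  - by rewrite zmap_comp; eexists _, _.
  have [l [h1 h2]] := zmap_inv k b; exists l, b.
  apply: functional_extensionality => z.
  have := congr1 (fun f => f (g z)) h1; rewrite /= gf => <-.
  by [].
rewrite /Gamma; case: odd; apply: H => f.
  by case=> ->; [exists m.+1, true; rewrite flipE|exists m.+2, false; rewrite turn_odd].
by case=> ->; [exists m.+1, true; rewrite flipE|exists 2%N, false; rewrite turn_two
  |exists m.+1, false; rewrite turn_PI].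
Qed.

Lemma generated_zmap (S : (cstar -> cstar) -> Prop) k b :
  S flip -> Defs.generated S (zmap 1 false) -> Defs.generated S (zmap k b).
Proof.
move=> hf h1; have hk l : Defs.generated S (zmap l false).
  elim: l => [|l IH]; first by rewrite zmap_id; apply: gen_id.
  by have := gen_comp h1 IH; rewrite zmap_comp.
(* [flip] already contains the factor -1 = [zeta m.+1]; the extra shift by m + 1 completes it to a
   full period. *)
case: b => //; have := gen_comp (hk (k + m.+1)%N) (gen_base hf).
rewrite flipE zmap_comp /= (_ : zmap _ _ = zmap k true) //; apply: zmap_ext => //.
rewrite -addnA (_ : (m.+1 + m.+1)%N = N); last by lia.
by rewrite zeta_add zeta_period Cmult_1_r.
Qed.

Lemma zmap_Gamma k b : Gamma m (zmap k b).
Proof.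
rewrite /Gamma; case: (boolP (odd m)) => hm; apply: generated_zmap.
- by left.
- set S := fun _ => _.
  have h0 : Defs.generated S (zmap m.+2 false).
    by apply: gen_base; right; rewrite turn_odd.
  have hk l : Defs.generated S (zmap (l * m.+2) false).
    elim: l => [|l IH]; first by rewrite zmap_id; apply: gen_id.
    by have := gen_comp h0 IH; rewrite zmap_comp.
  (* [m + 2] is its own inverse modulo [2 m + 2] for odd [m]. *)
  have -> : zmap 1 false = zmap (m.+2 * m.+2) false.
    apply: zmap_ext => //; rewrite -[RHS]zeta_mod -[LHS]zeta_mod; congr zeta.
    have -> : (m.+2 * m.+2 = m./2.+2 * N + 1)%N.
      by have := odd_double_half m; rewrite hm; nia.
    by rewrite modnMDl.
  exact: hk.
- by constructor 1.
set S := fun _ => _.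
have h0 : Defs.generated S (zmap 2 false).
  by apply: gen_base; constructor 2; rewrite turn_two.
have h1 : Defs.generated S (zmap m.+1 false).
  by apply: gen_base; constructor 3; rewrite turn_PI.
have hk l : Defs.generated S (zmap (l * 2) false).
  elim: l => [|l IH]; first by rewrite zmap_id; apply: gen_id.
  by have := gen_comp h0 IH; rewrite zmap_comp.
(* For even m, 2 and m + 1 are coprime: (m + 2) + (m + 1) = N + 1. *)
have := gen_comp (hk (m./2.+1)) h1; rewrite zmap_comp /=.
rewrite (_ : zmap _ _ = zmap 1 false) //; apply: zmap_ext => //.
have -> : (m./2.+1 * 2 + m.+1 = 1 + N)%N.
  by have := odd_double_half m; rewrite (negbTE hm) /=; lia.
by rewrite zeta_add zeta_period Cmult_1_r.
Qed.

Definition zmap_quot (k : nat) (b : bool) : Hquot -> Hquot := qmap (zmap k b).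

Lemma zmap_commutes k b : commutes_antipode (zmap k b).
Proof. exact: twist_map_commutes. Qed.

Lemma zmap_quot_induced k b : induces (zmap k b) (zmap_quot k b).
Proof. by apply: induces_qmap; apply: zmap_commutes. Qed.

Lemma Iso_zmap_quot phi : Iso m phi <-> exists k b, phi = zmap_quot k b.
Proof.
split=> [[[hs _] hm]|[k [b ->]]].
  have [c [b [hc hN h]]] := global_form hm hs.
  have [k ek] := zeta_surj hc hN; exists k, b.
  apply: induces_eq (zmap_quot_induced k b); apply/moved_twist_map.
  by rewrite -ek.
by apply: (moved_Iso (nsq_zt k) (zeta_root k)); apply/(moved_twist_map _ _ (nsq_zt k)); apply: zmap_quot_induced.
Qed.

Lemma zmap_quot_comp k b l c :
  zmap_quot k b \o zmap_quot l c = zmap_quot (k + (if b then N.-1 * l else l))%N (b (+) c).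
Proof.
apply: induces_eq (induces_comp (zmap_quot_induced _ _) (zmap_quot_induced _ _)) _.
by rewrite zmap_comp; apply: zmap_quot_induced.
Qed.

Lemma zmap_quot_ext k b l c : zeta k = zeta l -> b = c -> zmap_quot k b = zmap_quot l c.
Proof. by move=> h e; rewrite /zmap_quot (zmap_ext h e). Qed.

Lemma zmap_quot_id : zmap_quot 0 false = id.
Proof.
by apply: induces_eq (zmap_quot_induced _ _) _; rewrite zmap_id.
Qed.

(** Passing to the quotient makes the antipode trivial, but no two of these transformations become
    equal; this makes the maps to the abstract groups injective. *)
Lemma zmap_quot_inj k b l c : zmap_quot k b = zmap_quot l c -> k %% N = l %% N /\ b = c.
Proof.
move=> e; have h1 := zmap_quot_induced k b; have h2 := zmap_quot_induced l c.
rewrite -e in h2; pose zb : C := (2, 0).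
have hb : 1 < nsq zb by rewrite /nsq /Re /Im /=; lra.
have /moved_twist_map m1 := h1; have /moved_twist_map m2 := h2.
have e2 : (zeta k, b) = (zeta l, c).
  by apply: (@moved_unique (zmap_quot k b) _ _ _ _ zb) => //;
    [apply: nsq_zt|apply: nsq_zt|apply: filter_forall|apply: filter_forall].
split; last exact: (congr1 snd e2).
apply: zeta_inj; rewrite ?ltn_pmod ?addn2 // -addn2 !zeta_mod.
exact: (congr1 fst e2).
Qed.

End Zeta.

(** * Induced isometries of space *)

Lemma cos_shift k x :
  cos (x + INR k * PI) = if odd k then - cos x else cos x.
Proof.
elim: k => [|k IH]; first by rewrite Rmult_0_l Rplus_0_r.
rewrite S_INR (_ : x + _ = x + INR k * PI + PI); last by ring.
by rewrite neg_cos IH /=; case: odd => /=; ring.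
Qed.

Lemma sin_shift k x :
  sin (x + INR k * PI) = if odd k then - sin x else sin x.
Proof.
elim: k => [|k IH]; first by rewrite Rmult_0_l Rplus_0_r.
rewrite S_INR (_ : x + _ = x + INR k * PI + PI); last by ring.
by rewrite neg_sin IH /=; case: odd => /=; ring.
Qed.

Lemma induces_space_flip m : induces_space m flip reflect_x2x3.
Proof.
move=> z; rewrite -(modulus_argE z) flip_polar !X_polar.
move: (pos _) (arg z) => r t; rewrite /Hparam.
have E k : INR k * (PI - t) = - (INR k * t) + INR k * PI by ring.
case: (boolP (odd m)) => hm; rewrite !E !cos_shift !sin_shift;
  rewrite !oddS ?hm ?(negbTE hm) /= !cos_neg !sin_neg /reflect_x2x3.
  by congr (_, _, _); rewrite /Rdiv; ring.
by congr (_, _, _); rewrite /Rdiv; ring.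
Qed.

Lemma induces_space_turn m a (Psi : R * R * R -> R * R * R) :
  (forall r t, Hparam m r (t + a) = Psi (Hparam m r t)) ->
  induces_space m (turn a) Psi.
Proof. by move=> h z; rewrite -(modulus_argE z) turn_polar !X_polar. Qed.

(** The Chinese remainder theorem for the coprime factors 2 and m + 1. Both sums are below twice the
    modulus, so reduction subtracts it at most once and linear arithmetic concludes. *)
Lemma mixed_radix_inj m i j e d : ~~ odd m -> (i < m + 1)%N -> (j < m + 1)%N ->
  (e < 2)%N -> (d < 2)%N ->
  ((2 * i + m.+1 * e) %% (2 * m + 2) = (2 * j + m.+1 * d) %% (2 * m + 2))%N ->
  i = j /\ e = d.
Proof.
move=> hm hi hj he hd; have := odd_double_half m; rewrite (negbTE hm).
move: (m./2) => h em.
have small a : (a < 2 * (2 * m + 2))%N ->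
    (a %% (2 * m + 2) = a \/ a %% (2 * m + 2) + (2 * m + 2) = a)%N.
  move=> ha; case: (ltnP a (2 * m + 2)) => hN; first by left; rewrite modn_small.
  right; rewrite -{1}(subnK hN) modnDr modn_small ?subnK //; lia.
have hi2 : (2 * i + m.+1 * e < 2 * (2 * m + 2))%N by case: e he => [|[]] // _; lia.
have hj2 : (2 * j + m.+1 * d < 2 * (2 * m + 2))%N by case: d hd => [|[]] // _; lia.
move: (small _ hi2) (small _ hj2) => s1 s2 e12; rewrite e12 in s1.
move: (_ %% _)%N s1 s2 => r {small e12 hi2 hj2}.
by case: e he d hd => [|[|//]] _ [|[|//]] _; lia.
Qed.

Section Turns.

Variable m : nat.

Let n0 : INR m.+1 <> 0.
Proof. exact: not_0_INR. Qed.

Let E1 : INR m.+1 = INR m + 1. Proof. exact: S_INR. Qed.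
Let E2 : INR m.+2 = INR m + 2. Proof. by rewrite 2!S_INR; ring. Qed.
Let E3 : INR m.+3 = INR m + 3. Proof. by rewrite 3!S_INR; ring. Qed.

(** As m = (m + 1) - 1 and m + 2 = (m + 1) + 1, the shift enters the two horizontal frequencies as
    -a and +a, up to multiples of PI. The frequency m occurs in X with reversed orientation, so both
    terms rotate by +a. The even case works alike. *)
Lemma induces_space_turn_odd : odd m ->
  induces_space m (turn (PI + PI / INR m.+1))
    (reflect_x1x2 \o rotate_x3 (PI / INR m.+1)).
Proof.
move=> hm; apply: induces_space_turn => r t; rewrite /Hparam hm.
set a := PI / INR m.+1; have ea : INR m.+1 * a = PI by rewrite /a; field.
have -> : INR m * (t + (PI + a)) = INR m * t - a + INR m.+1 * PI.
  by rewrite E1 in ea *; lra.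
have -> : INR m.+1 * (t + (PI + a)) = INR m.+1 * t + INR m.+2 * PI.
  by rewrite E2; rewrite E1 in ea *; lra.
have -> : INR m.+2 * (t + (PI + a)) = INR m.+2 * t + a + INR m.+3 * PI.
  by rewrite E2 E3; rewrite E1 in ea; lra.
rewrite !cos_shift !sin_shift !oddS hm /= cos_minus sin_minus cos_plus sin_plus.
by congr (_, _, _); rewrite /Rdiv; ring.
Qed.

Lemma induces_space_turn_even : ~~ odd m ->
  induces_space m (turn (2 * PI / INR m.+1)) (rotate_x3 (2 * PI / INR m.+1)).
Proof.
move=> hm; apply: induces_space_turn => r t; rewrite /Hparam (negbTE hm).
set a := 2 * PI / INR m.+1; have ea : INR m.+1 * a = 2 * PI by rewrite /a; field.
have -> : INR m * (t + a) = INR m * t - a + INR 2 * PI.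
  by rewrite [INR 2]/=; rewrite E1 in ea; lra.
have -> : INR m.+1 * (t + a) = INR m.+1 * t + INR 2 * PI.
  by rewrite [INR 2]/=; lra.
have -> : INR m.+2 * (t + a) = INR m.+2 * t + a + INR 2 * PI.
  by rewrite [INR 2]/= E2; rewrite E1 in ea; lra.
rewrite !cos_shift !sin_shift /= cos_minus sin_minus cos_plus sin_plus.
by congr (_, _, _); rewrite /Rdiv; ring.
Qed.

Lemma induces_space_turn_PI : ~~ odd m -> induces_space m (turn PI) reflect_x1x2.
Proof.
move=> hm; apply: induces_space_turn => r t; rewrite /Hparam (negbTE hm).
have E k : INR k * (t + PI) = INR k * t + INR k * PI by ring.
rewrite !E !cos_shift !sin_shift !oddS (negbTE hm) /=.
by congr (_, _, _); rewrite /Rdiv; ring.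
Qed.

(** * The isomorphism types *)

Local Notation N := (2 * m + 2)%N.

(** The maps [zmap_quot m k b] multiply like the normal forms x^k y^b of the dihedral group of order
    2 N: rotations are powers of one of order N, and conjugation inverts them. *)
Lemma Iso_odd : isomorphic_to (Iso m) 'D_(2 * N).
Proof.
have [|nf [nfI nfq nf1 nfM nfS]] := @dihedral_normal_form (2 * N) N _ (mul2n _).
  by lia.
exists (fun x => zmap_quot m (nf x).1 (nf x).2); split.
- move=> x y /zmap_quot_inj []; rewrite !modn_small ?nfq // => e1 e2.
  by apply: nfI; rewrite (surjective_pairing (nf x)) e1 e2 -surjective_pairing.
- by rewrite nf1 zmap_quot_id.
- by move=> x y; rewrite nfM zmap_quot_comp; apply: zmap_quot_ext; rewrite ?zeta_mod.
move=> phi; split=> [/Iso_zmap_quot [k [b ->]]|[x <-]]; last by apply/Iso_zmap_quot; eexists _, _.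
have [|x ex] := nfS (k %% N) b; first by rewrite ltn_pmod // addn2.
by exists x; rewrite ex; apply: zmap_quot_ext => //; rewrite zeta_mod.
Qed.

(* The rotation by [PI] generates the central factor ['Z_2]. *)
Lemma Iso_even : (1 <= m)%N -> ~~ odd m ->
  isomorphic_to (Iso m) ('D_(2 * (m + 1))%N * 'Z_2)%type.
Proof.
move=> hm1 hm; have [|nf [nfI nfq nf1 nfM nfS]] :=
  @dihedral_normal_form (2 * (m + 1)) (m + 1) _ (mul2n _); first by lia.
(* A power of the rotation by 2 PI / (m + 1), times a power of the rotation by PI. *)
pose f (x : 'D_(2 * (m + 1)) * 'Z_2) : nat := (2 * (nf x.1).1 + m.+1 * x.2)%N.
have zeta2 k : zeta m (2 * (k %% (m + 1))) = zeta m (2 * k).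
  by rewrite -[RHS]zeta_mod muln_modr mulnDr muln1.
have ztn k : zeta m (m.+1 * (k %% 2)) = zeta m (m.+1 * k).
  by rewrite -[RHS]zeta_mod muln_modr; congr (zeta _ (_ %% _)); lia.
exists (fun x => zmap_quot m (f x) (nf x.1).2); split.
- move=> x y /zmap_quot_inj [e1 e2]; rewrite (surjective_pairing x) (surjective_pairing y).
  have [ea eb] := mixed_radix_inj hm (nfq x.1) (nfq y.1) (ltn_ord x.2) (ltn_ord y.2) e1.
  congr pair; last exact: val_inj.
  by apply: nfI; rewrite (surjective_pairing (nf _)) ea e2 -surjective_pairing.
- by rewrite /f /= nf1 -[RHS](zmap_quot_id m); apply: zmap_quot_ext => //; rewrite muln0.
- move=> x y; rewrite zmap_quot_comp /= nfM; apply: zmap_quot_ext => //.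
  rewrite /f /= nfM /dih_mul /=.
  rewrite -[(Zp_trunc 2).+2]/2%N [LHS]zeta_add zeta2 ztn [RHS]zeta_add.
  rewrite !(mulnDr _ _ (if _ then _ else _)) (mulnDr _ (nat_of_ord x.2)).
  rewrite !(zeta_add _ (2 * (nf x.1).1)) (zeta_add _ (m.+1 * x.2)).
  have C4 (a b c d : C) : (a * b * (c * d) = a * c * (b * d))%C by ring.
  case: (nf x.1).2; last by rewrite (zeta_add _ (2 * (nf y.1).1)) C4.
  rewrite -zeta_conj (zeta_add _ (2 * _)) Cmult_conj C4; congr (_ * (_ * _))%C.
    apply: zeta_conj_eq; rewrite (_ : (_ + _)%N = ((nf y.1).1 * N)%N) ?zeta_mulN //.
    by move: (nf y.1).1 => j; rewrite addn1 /=; lia.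
  (* The central factor is a power of -1, hence real: conjugation leaves it unchanged. *)
  apply: zeta_conj_eq; rewrite (_ : (_ + _)%N = (y.2 * N)%N) ?zeta_mulN //.
  by move: (nat_of_ord y.2) => j; rewrite addnn -mul2n; nia.
move=> phi; split=> [/Iso_zmap_quot [k [b ->]]|[x <-]]; last by apply/Iso_zmap_quot; eexists _, _.
(* As m + 1 is odd, the parity of k determines the central component. Adding (m + 1) [odd k] makes
   the index even, and the same amount in [f] completes it to a multiple of N. *)
pose i := ((k + m.+1 * odd k)./2 %% (m + 1))%N.
have [|x ex] := nfS i b; first by rewrite ltn_pmod // addn1.
exists (x, inZp (odd k)); rewrite /f /= ex /=; apply: zmap_quot_ext => //.
rewrite zeta_add zeta2 ztn -zeta_add.
have -> : (2 * (k + m.+1 * odd k)./2 = k + m.+1 * odd k)%N.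
  have ho : odd (k + m.+1 * odd k) = false.
    by rewrite oddD oddM [odd m.+1]/= hm; case: (odd k).
  by rewrite mul2n -[RHS]odd_double_half ho.
rewrite -addnA -mulnDr (_ : (m.+1 * _)%N = (odd k * N)%N); last by lia.
by rewrite zeta_add zeta_mulN Cmult_1_r.
Qed.

End Turns.

Theorem lemma9 (m : nat) (hm : (1 <= m)%N) :
  (* Iso(H_m) consists exactly of the maps induced by Gamma_m *)
  (forall T, Gamma m T -> commutes_antipode T) /\
  (forall phi, Iso m phi <-> exists T, Gamma m T /\ induces T phi) /\
  (* isometries of space induced by the generators *)
  (odd m ->
     induces_space m flip reflect_x2x3 /\
     induces_space m (turn (PI + PI / INR m.+1))
       (reflect_x1x2 \o rotate_x3 (PI / INR m.+1))) /\
  (~~ odd m ->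
     induces_space m flip reflect_x2x3 /\
     (exists a : R, Rabs a = 2 * PI / INR m.+1 /\
        induces_space m (turn (2 * PI / INR m.+1)) (rotate_x3 a)) /\
     induces_space m (turn PI) reflect_x1x2) /\
  (* abstract structure; the index of 'D is the order of the group *)
  (odd m -> isomorphic_to (Iso m) 'D_(2 * (2 * m + 2))%N) /\
  (~~ odd m -> isomorphic_to (Iso m) ('D_(2 * (m + 1))%N * 'Z_2)%type).
Proof.
split; first by move=> T /Gamma_zmap [k [b ->]]; apply: zmap_commutes.
split.
  move=> phi; split=> [/Iso_zmap_quot [k [b ->]]|[T [/Gamma_zmap [k [b ->]] hT]]].
    by exists (zmap m k b); split; [apply: zmap_Gamma | apply: zmap_quot_induced].
  by apply/Iso_zmap_quot; exists k, b; apply: induces_eq hT (zmap_quot_induced _ _ _).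
split; first by split; [apply: induces_space_flip | apply: induces_space_turn_odd].
split.
  move=> em; split; first exact: induces_space_flip.
  split; last exact: induces_space_turn_PI.
  exists (2 * PI / INR m.+1); split; last exact: induces_space_turn_even.
  apply: Rabs_pos_eq; apply: Rmult_le_pos; first by have := PI_RGT_0; lra.
  by apply/Rlt_le/Rinv_0_lt_compat/lt_0_INR; lia.
by split=> em; [apply: Iso_odd | apply: Iso_even].
Qed.
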